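(* Let $x(\tau)$, $\tau\ge 0$, be a standard one-dimensional Brownian motion started at $x(0)=0$, let $t>0$ and $0\le r\le 1$. Then, conditionally on the end point being nonnegative, $$\mathbf{P}\bigl(\mu(\{\tau\in[0,t] : x(\tau)\ge 0\})\le rt\ \big|\ x(t)\ge 0\bigr)=\frac{2}{\pi}\int_0^{r}\frac{x\,dx}{\sqrt{x(1-x)}}=\frac{2}{\pi}\int_0^{r}\sqrt{\frac{x}{1-x}}\,dx,$$ and dually, $$\mathbf{P}\bigl(\mu(\{\tau\in[0,t] : x(\tau)\le 0\})\le rt\ \big|\ x(t)\ge 0\bigr)=\frac{2}{\pi}\int_0^{r}\frac{(1-x)\,dx}{\sqrt{x(1-x)}}=\frac{2}{\pi}\int_0^{r}\sqrt{\frac{1-x}{x}}\,dx.$$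
   Context: $\mu$ denotes Lebesgue measure on the real line. Inside the integrals, $x$ is a real integration variable, not the Brownian motion. $\mathbf{P}(A\mid B)$ is the usual conditional probability. *)

(* Defs.v *)
From HB Require Import structures.
From mathcomp Require Import all_boot all_order all_algebra.
From mathcomp Require Import all_classical all_reals all_analysis.

Set Implicit Arguments.
Unset Strict Implicit.
Unset Printing Implicit Defensive.

Import Order.TTheory GRing.Theory Num.Theory.
Import numFieldNormedType.Exports.

Local Open Scope classical_set_scope.
Local Open Scope ring_scope.

(* Only meaningful when B has positive probability. *)
Definition cond_prob d (T : measurableType d) (R : realType)
    (P : probability T R) (A B : set T) : \bar R :=
  (P (A `&` B) / P B)%E.

(* The product rule over the whole finite index set covers every subfamily:
   take A i = setT outside the subfamily. *)
Definition mutually_independent d (T : measurableType d) (R : realType)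
    (P : probability T R) (I : finType) (X : I -> T -> R) : Prop :=
  forall A : I -> set R, (forall i, measurable (A i)) ->
    P (\bigcap_i (X i @^-1` A i)) = (\prod_i P (X i @^-1` A i))%E.

(* Time ranges over all of R for typing reasons only: the random variables at
   negative times are unconstrained.  The law of an increment is compared with
   the normal law on measurable sets only, since a measure has unspecified
   values elsewhere; the second parameter of normal_prob is the standard
   deviation. *)
Record standard_brownian_motion d (T : measurableType d) (R : realType)
    (P : probability T R) (x : R -> {RV P >-> R}) : Prop :=
  StandardBrownianMotion {
    sbm_start : forall w : T, x 0 w = 0 ;
    sbm_independent_increments :
      forall (n : nat) (s : nat -> R), 0 <= s 0%N -> nondecreasing_seq s ->
        mutually_independent
          P (fun i : 'I_n => x (s i.+1) \- x (s i)) ;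
    sbm_gaussian_increments :
      forall (s u : R) (A : set R), 0 <= s -> s < u -> measurable A ->
        P ((x u \- x s) @^-1` A) = normal_prob 0 (Num.sqrt (u - s)) A ;
    sbm_continuous_paths :
      forall w : T, {within `[0, +oo[, continuous (fun s : R => x s w)}
  }.

Arguments standard_brownian_motion {d T R} P x.

(* Main.v *)
(* Sample the path at the times i t / n.  The increments are i.i.d. and
   symmetric, and for n such increments with partial sums S_1, ..., S_n let N_n
   be the number of positive S_i.  Moving an increment to the front whenever
   the current partial sum is positive preserves the law of the increments and
   turns N_n into the index of the first maximum of the walk (Sparre Andersen,
   Feller), which splits at the maximum into two independent pieces; hence
   P(N_n = k) = a_k a_{n-k} with a_k = C(2k,k) / 4^k.  Comparing n with n - 1
   refines this to P(N_n = k, S_n > 0) = (k / n) a_k a_{n-k}.  By Wallis'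
   integrals a_k a_{n-k} is the arcsine mixture of the binomial weights
   C(n,k) y^k (1 - y)^(n-k), y = sin^2 u with u uniform on [0, pi/2], so
   Bernstein's theorem gives the limit of E[g(N_n / n); S_n > 0], while
   N_n / n converges almost surely to the fraction of time spent in (0, oo).
   Letting g decrease to an indicator yields both laws. *)

Require Import Defs.
From HB Require Import structures.
From mathcomp Require Import all_boot all_order all_algebra.
From mathcomp Require Import all_classical all_reals all_analysis.
From mathcomp Require Import measurable_realfun.
From mathcomp Require Import ring lra zify.

Set Implicit Arguments.
Unset Strict Implicit.
Unset Printing Implicit Defensive.

Import Order.TTheory GRing.Theory Num.Theory.
Import numFieldNormedType.Exports.

Local Open Scope classical_set_scope.
Local Open Scope ring_scope.

(** * Rearranging partial sums *)

(** The delicate point is strictness. The rearrangement is exact for strictly positive sums and for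
    the leftmost maximum, while the theorem has weak inequalities; the discrepancies are null
    events, removed once for the walk (almost surely no partial sum vanishes) and once for the path
    (its zero set is null by Fubini). The rearrangements act on laws, so the grid increments are
    pushed forward to [nat -> R] with the cylinder sigma-algebra, where permutation, reversal and
    reflection are measurable maps preserving the law. The weight k / n gained by requiring S_n > 0
    turns the arcsine density into y / sqrt(y (1 - y)), and dividing by the probability 1/2 of the
    condition turns 1 / pi into 2 / pi. In the angle u every density is a multiple of sin^2 u, so
    singular integrands occur only at the end, in the substitutions y = sin^2 u and y = cos^2 u. The
    dual law needs no second limit theorem: the time spent in the nonpositive half-line is t minus
    the time spent in the positive one, so only the direction of an inequality changes. *)

Definition psum (R : nmodType) (z : nat -> R) (n : nat) : R := \sum_(i < n) z i.

Definition pos_count (R : realType) (n : nat) (z : nat -> R) : nat :=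
  (\sum_(i < n) (0 < psum z i.+1)%R)%N.

Definition move_to_front (T : Type) (n : nat) (z : nat -> T) : nat -> T :=
  fun i => if i == 0%N then z n else if (i <= n)%N then z i.-1 else z i.

(** Each stage permutes only the entries seen so far, so the test on [psum y m.+1] reads a partial
    sum of the original sequence. *)
Fixpoint reorder (R : realType) (n : nat) (z : nat -> R) : nat -> R :=
  if n is m.+1 then
    let y := reorder m z in
    if 0 < psum y m.+1 then move_to_front m y else y
  else z.

(** Strict before [k] and weak after it: this singles out the leftmost maximum, so that [k] is
    unique even if the walk has ties. *)
Definition first_max (R : realType) (n k : nat) (z : nat -> R) : Prop :=
  [/\ (k <= n)%N, forall j, (j < k)%N -> psum z j < psum z k
    & forall j, (k <= j <= n)%N -> psum z j <= psum z k].

Section partial_sums.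
Context {R : realType}.
Implicit Types z : nat -> R.

Lemma psum0 z : psum z 0 = 0.
Proof. by rewrite /psum big_ord0. Qed.

Lemma psumS z n : psum z n.+1 = psum z n + z n.
Proof. by rewrite /psum big_ord_recr. Qed.

Lemma psumD z k n : psum z (k + n) = psum z k + psum (fun i => z (k + i)%N) n.
Proof.
elim: n => [|n IHn]; first by rewrite addn0 psum0 addr0.
by rewrite addnS !psumS IHn addrA.
Qed.

Lemma eq_psum z z' n : (forall i, (i < n)%N -> z i = z' i) ->
  psum z n = psum z' n.
Proof. by move=> zz'; apply: eq_bigr => i _; exact: zz'. Qed.

Lemma psumN z n : psum (fun i => - z i) n = - psum z n.
Proof. by rewrite /psum sumrN. Qed.

Lemma psum_move_to_front z n j : (j <= n)%N ->
  psum (move_to_front n z) j.+1 = z n + psum z j.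
Proof.
move=> jn; rewrite /psum big_ord_recl; congr (_ + _).
apply: eq_bigr => i _; rewrite lift0 /move_to_front/=.
by rewrite (leq_trans _ jn).
Qed.

Lemma psum_move_to_front_ge z n m : (n < m)%N ->
  psum (move_to_front n z) m = psum z m.
Proof.
elim: m => // m IHm; rewrite ltnS leq_eqVlt => /predU1P[<-|nm].
  by rewrite psum_move_to_front// psumS addrC.
rewrite !psumS IHm//; congr (_ + _).
by rewrite /move_to_front gtn_eqF ?(leq_trans _ nm)// leqNgt nm.
Qed.

Lemma psum_reorder z n m : (n <= m)%N -> psum (reorder n z) m = psum z m.
Proof.
elim: n => //= n IHn nm; case: ifPn => _; last by rewrite IHn// ltnW.
by rewrite psum_move_to_front_ge// IHn// ltnW.
Qed.

Lemma pos_countS z n :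
  pos_count n.+1 z = (pos_count n z + (0 < psum z n.+1)%R)%N.
Proof. by rewrite /pos_count big_ord_recr. Qed.

Lemma pos_count_le z n : (pos_count n z <= n)%N.
Proof.
elim: n => [|n IHn]; first by rewrite /pos_count big_ord0.
by rewrite pos_countS -addn1 leq_add// leq_b1.
Qed.

Lemma first_max_uniq z n k k' : first_max n k z -> first_max n k' z -> k = k'.
Proof.
move=> [kn k1 k2] [kn' k1' k2']; case: (ltngtP k k') => // kk'.
- by have := k1' _ kk'; rewrite ltNge k2// kn' ltnW.
- by have := k1 _ kk'; rewrite ltNge k2'// kn ltnW.
Qed.

(** The new walk is the old one raised by [z n] and preceded by the value 0, so the index moves by
    one. The starting value 0 does not win, because the raised maximum is at least [psum z n + z n],
    which is positive. *)
Lemma first_max_move_to_front z n k : 0 < psum z n.+1 ->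
  first_max n k z -> first_max n.+1 k.+1 (move_to_front n z).
Proof.
move=> S0 [kn k1 k2]; split => // j.
- rewrite psum_move_to_front//; case: j => [_|j jk].
    rewrite psum0 (lt_le_trans S0)// psumS addrC lerD2l.
    by rewrite k2// kn leqnn.
  by rewrite psum_move_to_front ?ltrD2l ?k1// (leq_trans _ kn)// ltnW.
- case: j => // j /andP[kj jn].
  by rewrite !psum_move_to_front// lerD2l k2// -ltnS kj.
Qed.

(** The new value is at most 0, which is the starting value of the walk and hence at most its
    maximum. *)
Lemma first_maxS z n k : psum z n.+1 <= 0 ->
  first_max n k z -> first_max n.+1 k z.
Proof.
move=> S0 [kn k1 k2]; split => //; first exact: leqW.
move=> j /andP[kj]; rewrite leq_eqVlt => /predU1P[->|jn]; last first.
  by apply: k2; rewrite kj.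
rewrite (le_trans S0)// -(psum0 z).
by case: k k1 {kn k2 kj} => // k k1; rewrite ltW// k1.
Qed.

Lemma first_max_reorder z n : first_max n (pos_count n z) (reorder n z).
Proof.
elim: n => [|n IHn].
  by rewrite /pos_count big_ord0; split => // j; rewrite leqn0 => /eqP ->.
rewrite pos_countS/= psum_reorder//; case: ifPn => S0.
  by rewrite addn1; apply: first_max_move_to_front; rewrite ?psum_reorder.
by rewrite addn0; apply: first_maxS; rewrite ?psum_reorder// leNgt.
Qed.

End partial_sums.

(** * Independent identically distributed sequences *)

Definition cylinder (R : realType) (m : nat) (A : nat -> set R) :
    set (nat -> R) :=
  [set z | forall i, (i < m)%N -> A i (z i)].

(** Finite boxes are stable under intersection, so a finite measure on the sigma-algebra they
    generate is determined by its values on them. *)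
Definition cylinders (R : realType) : set (set (nat -> R)) :=
  [set C | exists m A, (forall i, measurable (A i)) /\ C = cylinder m A].

Notation path_space R := (g_sigma_algebraType (@cylinders R)).

Section path_space.
Context {R : realType}.
Implicit Types (A : nat -> set R) (B C : set (path_space R)).

Lemma measurable_cylinder m A : (forall i, measurable (A i)) ->
  measurable (cylinder m A : set (path_space R)).
Proof. by move=> mA; apply: sub_sigma_algebra; exists m, A. Qed.

Lemma cylinder_widen m n A : (m <= n)%N ->
  cylinder m A = cylinder n (fun i => if (i < m)%N then A i else setT).
Proof.
move=> mn; apply/seteqP; split=> z zA i; first by case: ifPn => // im _; exact:
  zA.
by move=> im; have := zA i (leq_trans im mn); rewrite im.
Qed.

Lemma measurable_coord i : measurable_fun setT (fun z : path_space R => z i).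
Proof.
move=> _ A mA; rewrite setTI.
rewrite (_ : _ @^-1` _ = cylinder i.+1 (fun j => if j == i then A else setT)).
  by apply: measurable_cylinder => j; case: ifP.
apply/seteqP; split=> z /=.
  by move=> zA j _; case: eqP => // ->.
by move=> /(_ i (ltnSn i)); rewrite eqxx.
Qed.

Lemma measurable_path d (T : measurableType d) (f : T -> path_space R) :
  (forall i, measurable_fun setT (fun w => f w i)) -> measurable_fun setT f.
Proof.
move=> mf; apply: (@measurability _ _ _ (path_space R) setT f (@cylinders R))
  => //.
move=> _ [_ [m [A [mA ->]]] <-]; rewrite setTI.
rewrite (_ : _ @^-1` _ = \bigcap_(i in `I_m) ((fun w => f w i) @^-1` A i)) //.
apply: bigcap_measurableType => i _.
by rewrite -[X in measurable X]setTI; exact: mf.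
Qed.

Lemma measurable_psum n : measurable_fun setT (fun z : path_space R => psum z
  n).
Proof. by apply: measurable_sum => i; exact: measurable_coord. Qed.

Lemma cylinders_setI : setI_closed (@cylinders R).
Proof.
move=> _ _ [m [A [mA ->]]] [n [A' [mA' ->]]].
exists (maxn m n), (fun i => (if (i < m)%N then A i else setT) `&`
  (if (i < n)%N then A' i else setT)); split.
  by move=> i; apply: measurableI; case: ifP.
rewrite (cylinder_widen A (leq_maxl m n)) (cylinder_widen A' (leq_maxr m n)).
by apply/seteqP; split=> z /= => [[zA zA'] i im|zAA']; [split; [exact:
  zA|exact: zA']|
  split=> i im; have [] := zAA' i im].
Qed.

Lemma eq_measure_cylinder (m1 m2 : {measure set (path_space R) -> \bar R}) :
  (m1 setT < +oo)%E ->
  (forall m A, (forall i, measurable (A i)) ->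
    m1 (cylinder m A) = m2 (cylinder m A)) ->
  forall B, measurable B -> m1 B = m2 B.
Proof.
move=> m1oo m12 B mB.
apply: (@measure_unique _ R (path_space R) (@cylinders R) (fun=> setT)) => //.
- exact: cylinders_setI.
- move=> _; exists 0%N, (fun=> setT); split=> //.
  by apply/seteqP; split.
- by rewrite bigcup_const.
- by move=> _ [m [A [mA ->]]]; exact: m12.
Qed.

End path_space.

(** The total mass 1 keeps the product formula consistent when a box is widened by unconstrained
    coordinates. *)
Definition iid_law (R : realType) (nu : set R -> \bar R)
    (Q : set (path_space R) -> \bar R) : Prop :=
  nu setT = 1%E /\ forall m A, (forall i, measurable (A i)) ->
    Q (cylinder m A) = (\prod_(i < m) nu (A i))%E.

Section iid.
Context {R : realType}.
Variables (nu : set R -> \bar R) (Q : probability (path_space R) R).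
Hypothesis iidQ : iid_law nu Q.
Implicit Types (A : nat -> set R) (B C : set (path_space R)).

Lemma iid_preimage (f : path_space R -> path_space R) :
  measurable_fun setT f ->
  (forall m A, (forall i, measurable (A i)) ->
    Q (f @^-1` cylinder m A) = (\prod_(i < m) nu (A i))%E) ->
  forall B, measurable B -> Q (f @^-1` B) = Q B.
Proof.
move=> mf fQ B mB.
pose g : {mfun path_space R >-> path_space R} := mfun_Sub (mem_set mf).
change (distribution Q g B = Q B); apply: eq_measure_cylinder => //.
  by rewrite -[ltLHS]/(Q setT) probability_setT ltry.
by move=> m A mA; apply: (eq_trans (fQ m A mA)); apply/esym; exact: iidQ.2.
Qed.

Lemma iid_permute (s s' : nat -> nat) M : cancel s s' -> cancel s' s ->
  (forall i, (M <= i)%N -> s i = i) ->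
  forall B, measurable B -> Q ((fun z : path_space R => z \o s) @^-1` B) = Q B.
Proof.
move=> ss' s's sM; apply: iid_preimage.
  by apply: measurable_path => i; exact: measurable_coord.
(* [K] bounds both the box and the indices moved by [s], so [s] permutes the indices below [K] and
   the product over them can be reindexed. *)
move=> m A mA; pose K := maxn m M.
pose A' i := if (i < m)%N then A i else setT.
have mA' i : measurable (A' i) by rewrite /A'; case: ifP.
have sK i : (s i < K)%N = (i < K)%N.
  have sK' j : (K <= j)%N -> s j = j.
    by move=> Kj; apply: sM; rewrite (leq_trans _ Kj)// leq_maxr.
  case: (ltnP i K) => iK; last by rewrite sK'// ltnNge iK.
  by rewrite ltnNge; apply/negP => /[dup] /sK'/(can_inj ss') ->; rewrite leqNgt
    iK.
rewrite (cylinder_widen A (leq_maxl m M)) -/K -/A'.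
rewrite (_ : _ @^-1` _ = cylinder K (A' \o s')); last first.
  apply/seteqP; split=> z /= zA i iK.
    by rewrite -[in z i](s's i); apply: zA; rewrite -sK s's.
  by have := zA (s i); rewrite /= ss' sK; exact.
rewrite iidQ.2; last by move=> i; exact: mA'.
have <- : (\prod_(i < K) nu (A' i) = \prod_(i < m) nu (A i))%E.
  rewrite (big_ord_widen K (fun i => nu (A i))) ?leq_maxl//.
  rewrite [RHS]big_mkcond/=; apply: eq_bigr => i _.
  by rewrite /A'; case: ifP => // _; exact: iidQ.1.
have sK2 (i : 'I_K) : (s i < K)%N by rewrite sK.
have s'K2 (i : 'I_K) : (s' i < K)%N by rewrite -sK s's.
rewrite (reindex (fun i => Ordinal (sK2 i)))/=.
  by apply: eq_bigr => i _; rewrite ss'.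
exists (fun i => Ordinal (s'K2 i)) => i _; apply/val_inj => /=.
  exact: ss'.
exact: s's.
Qed.

Lemma iid_move_to_front n B : measurable B ->
  Q ((move_to_front n : path_space R -> path_space R) @^-1` B) = Q B.
Proof.
pose s i := if i == 0%N then n else if (i <= n)%N then i.-1 else i.
pose s' i := if i == n then 0%N else if (i < n)%N then i.+1 else i.
rewrite (_ : move_to_front n = fun z : path_space R => z \o s); last first.
  by apply/funext => z; apply/funext => i; rewrite /move_to_front /s/=; case:
    eqP => // _; case: leqP.
apply: (@iid_permute s s' n.+1).
- by move=> i; rewrite /s /s'; do ! case: ifPn; lia.
- by move=> i; rewrite /s /s'; do ! case: ifPn; lia.
- by move=> i; rewrite /s; do ! case: ifPn; lia.
Qed.

Definition path_rev k (z : nat -> R) : nat -> R :=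
  fun i => z (if (i < k)%N then (k.-1 - i)%N else i).

Lemma iid_rev k B : measurable B ->
  Q ((path_rev k : path_space R -> path_space R) @^-1` B) = Q B.
Proof.
pose s i := if (i < k)%N then (k.-1 - i)%N else i.
have ss i : s (s i) = i by rewrite /s; do ! case: ifPn; lia.
apply: (@iid_permute s s k) => //.
by move=> i; rewrite /s; case: ifPn; lia.
Qed.

Lemma iid_opp : (forall D : set R, measurable D -> nu (-%R @^-1` D) = nu D) ->
  forall B, measurable B ->
  Q ((fun z : path_space R => (fun i => - z i) : path_space R) @^-1` B) = Q B.
Proof.
move=> nuN; apply: iid_preimage.
  apply: measurable_path => i; apply: measurableT_comp => //.
  exact: measurable_coord.
move=> m A mA.
rewrite (_ : _ @^-1` _ = cylinder m (fun i => -%R @^-1` A i))//.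
rewrite iidQ.2; first by apply: eq_bigr => i _; exact: nuN.
by move=> i; rewrite -[X in measurable X]setTI; exact: oppr_measurable.
Qed.

(** The past is padded with zeros instead of being sent to a finite product, so that past and future
    live in the same measurable space. *)
Definition path_trunc k (z : path_space R) : path_space R :=
  fun i => if (i < k)%N then z i else 0.

Definition path_shift k (z : path_space R) : path_space R :=
  fun i => z (k + i)%N.

Lemma measurable_path_trunc k : measurable_fun setT (path_trunc k).
Proof.
apply: measurable_path => i; rewrite /path_trunc.
by case: (i < k)%N; [exact: measurable_coord|exact: measurable_cst].
Qed.

Lemma measurable_path_shift k : measurable_fun setT (path_shift k).
Proof. by apply: measurable_path => i; exact: measurable_coord. Qed.

(** Beyond [k] the truncated path is constantly 0, so the constraints there either all hold or make
    the preimage empty. *)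
Lemma preimage_path_trunc k m A :
  path_trunc k @^-1` cylinder m A = set0 \/
  path_trunc k @^-1` cylinder m A =
    cylinder k (fun i => if (i < m)%N then A i else setT).
Proof.
have [A0|A0] := pselect (forall i, (k <= i < m)%N -> A i 0); [right|left].
  apply/seteqP; split=> z /= zA i ik.
    by case: ifPn => // im; have := zA i im; rewrite /path_trunc ik.
  rewrite /path_trunc; case: ifPn => [ik'|].
    by have := zA i ik'; rewrite ik.
  by rewrite -leqNgt => ki; apply: A0; rewrite ki.
apply/seteqP; split=> // z /= zA; apply: A0 => i /andP[ki im].
by have := zA i im; rewrite /path_trunc ltnNge ki.
Qed.

Let iid_indep_cylinder k m A n A' : (forall i, measurable (A i)) ->
  (forall i, measurable (A' i)) ->
  (Q (path_trunc k @^-1` cylinder m A `&` path_shift k @^-1` cylinder n A') =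
   Q (path_trunc k @^-1` cylinder m A) * Q (cylinder n A'))%E.
Proof.
move=> mA mA'; have [->|->] := preimage_path_trunc k m A.
  by rewrite set0I measure0 mul0e.
set A1 := (X in cylinder k X).
have mA1 i : measurable (A1 i) by rewrite /A1; case: ifP.
rewrite (_ : _ `&` _ =
  cylinder (k + n) (fun i => if (i < k)%N then A1 i else A' (i - k)%N)).
  rewrite !iidQ.2//; last by move=> i; case: ifP.
  rewrite big_split_ord/=; congr (_ * _)%E; apply: eq_bigr => i _.
    by rewrite ltn_ord.
  by rewrite ltnNge leq_addr/= addKn.
apply/seteqP; split=> z /=.
  move=> [zA zA'] i ikn; case: ifPn => [/zA//|]; rewrite -leqNgt => ki.
  by have := zA' (i - k)%N; rewrite /path_shift subnKC//; apply; lia.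
move=> zA; split=> i im.
  by have := zA i; rewrite im (leq_trans im)//; [exact|exact: leq_addr].
by have := zA (k + i)%N; rewrite ltn_add2l im ltnNge leq_addr/= addKn; exact.
Qed.

Let mtrunc k B : measurable B -> measurable (path_trunc k @^-1` B).
Proof. by move=> mB; rewrite -[X in measurable X]setTI; exact:
  measurable_path_trunc. Qed.

Let mshift k B : measurable B -> measurable (path_shift k @^-1` B).
Proof. by move=> mB; rewrite -[X in measurable X]setTI; exact:
  measurable_path_shift. Qed.

(** Uniqueness of measures is applied twice: the past varies against a fixed cylinder of the future,
    then the future varies against a fixed past. Each time one side is a restriction pushed forward
    and the other a scalar multiple of a measure. *)
Lemma iid_indep k B C : measurable B -> measurable C ->
  (Q (path_trunc k @^-1` B `&` path_shift k @^-1` C) =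
   Q (path_trunc k @^-1` B) * Q C)%E.
Proof.
have scale D : measurable D -> exists r : {nonneg R}, r%:num%:E = Q D.
  move=> mD; have r0 : 0 <= fine (Q D) by rewrite fine_ge0.
  by exists (NngNum r0); rewrite /= fineK// fin_num_measure.
have mtr := measurable_path_trunc k; have msh := measurable_path_shift k.
have indepC m A : (forall i, measurable (A i)) -> forall B, measurable B ->
    (Q (path_trunc k @^-1` B `&` path_shift k @^-1` cylinder m A) =
     Q (path_trunc k @^-1` B) * Q (cylinder m A))%E.
  move=> mA {}B mB; have mC := measurable_cylinder m mA.
  have [r rE] := scale _ mC.
  pose m1 : {measure set _ -> \bar R} := pushforward (mrestr Q (mshift k mC))
    (path_trunc k).
  pose m2 : {measure set _ -> \bar R} := mscale r (pushforward Q (path_trunc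
    k)).
  rewrite muleC -rE; change (m1 mtr B = m2 mtr B).
  apply: eq_measure_cylinder => //.
    rewrite /m1/= /pushforward /mrestr preimage_setT setTI.
    by rewrite (le_lt_trans (probability_le1 _ _)) ?ltry//; exact: mshift.
  move=> n A' mA'; rewrite /m1 /m2 /pushforward /mrestr /= /mscale /pushforward
    rE.
  by rewrite muleC; exact: iid_indep_cylinder.
move=> mB mC; have [r rE] := scale _ (mtrunc k mB).
pose m1 : {measure set _ -> \bar R} := pushforward (mrestr Q (mtrunc k mB))
  (path_shift k).
pose m2 : {measure set _ -> \bar R} := mscale r Q.
rewrite -rE setIC; change (m1 msh C = m2 C).
apply: eq_measure_cylinder => //.
  rewrite /m1/= /pushforward /mrestr preimage_setT setTI.
  by rewrite (le_lt_trans (probability_le1 _ _)) ?ltry//; exact: mtrunc.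
move=> n A mA; rewrite /m1 /m2/= /pushforward /mrestr /mscale rE setIC.
exact: indepC.
Qed.

End iid.

(** * The discrete arcsine law *)

Section measurable_comparison.
Context d (T : measurableType d) (R : realType) (f g : T -> R).
Hypotheses (mf : measurable_fun setT f) (mg : measurable_fun setT g).

Lemma measurable_set_ltr : measurable [set w | f w < g w].
Proof.
have := measurable_fun_ltr mf mg measurableT.
by move=> /(_ [set true] I); rewrite setTI.
Qed.

Lemma measurable_set_ler : measurable [set w | f w <= g w].
Proof.
have := measurable_fun_ler mf mg measurableT.
by move=> /(_ [set true] I); rewrite setTI.
Qed.

End measurable_comparison.

Lemma measurable_preimageT d d' (T : measurableType d) (T' : measurableType d')
    (f : T -> T') B :
  measurable_fun setT f -> measurable B -> measurable (f @^-1` B).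
Proof. by move=> mf mB; rewrite -[X in measurable X]setTI; exact: mf. Qed.

Section arcsine_weight.
Context {R : realType}.

(* [a_k = 'C(2k, k) / 4^k] *)
Definition arcsine_weight (k : nat) : R :=
  \prod_(i < k) ((i%:R + 2^-1) / (i%:R + 1)).

Local Notation a := arcsine_weight.

Lemma arcsine_weight0 : a 0 = 1.
Proof. by rewrite /arcsine_weight big_ord0. Qed.

Lemma arcsine_weightS k : (k%:R + 1) * a k.+1 = (k%:R + 2^-1) * a k.
Proof.
rewrite /arcsine_weight big_ord_recr/=.
by field; rewrite natr1 pnatr_eq0.
Qed.

(** This is the square of the series of (1 - x)^(-1/2). Exchanging k and n + 1 - k gives (n + 1) c =
    2 sum k a_k a_(n+1-k); the recursion of the weights lowers this to 2 sum (k + 1/2) a_k a_(n-k),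
    and a second exchange makes the coefficient the constant n + 1. *)
Lemma sum_arcsine_weight n : \sum_(k < n.+1) a k * a (n - k)%N = 1.
Proof.
elim: n => [|n IHn].
  by rewrite big_ord_recl big_ord0/= subnn arcsine_weight0 mulr1 addr0.
set c := LHS; suff : n.+1%:R * c = n.+1%:R.
  by move=> h; apply: (mulfI (x := n.+1%:R)); rewrite ?h ?mulr1 ?pnatr_eq0.
have sym : \sum_(k < n.+2) k%:R * (a k * a (n.+1 - k)%N) =
           \sum_(k < n.+2) (n.+1 - k)%:R * (a k * a (n.+1 - k)%N) :> R.
  rewrite [LHS](reindex_inj rev_ord_inj)/=; apply: eq_bigr => k _.
  by rewrite subSS (subKn (leq_ord k)) [a (_ - _)%N * _]mulrC.
have E : n.+1%:R * c = 2 * \sum_(k < n.+2) k%:R * (a k * a (n.+1 - k)%N).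
  rewrite [RHS]mulr_natl mulr2n {2}sym -big_split/= /c mulr_sumr.
  by apply: eq_bigr => k _; rewrite -mulrDl -natrD subnKC// -ltnS.
rewrite E big_ord_recl/= mul0r add0r.
have sym' : \sum_(k < n.+1) (k%:R + 2^-1) * (a k * a (n - k)%N) =
           \sum_(k < n.+1) ((n - k)%:R + 2^-1) * (a k * a (n - k)%N) :> R.
  rewrite [LHS](reindex_inj rev_ord_inj)/=; apply: eq_bigr => k _.
  by rewrite subSS (subKn (leq_ord k)) [a (_ - _)%N * _]mulrC.
transitivity (2 * \sum_(k < n.+1) (k%:R + 2^-1) * (a k * a (n - k)%N)).
  congr (_ * _); apply: eq_bigr => k _.
  by rewrite /bump leq0n add1n subSS mulrA -natr1 arcsine_weightS mulrA.
rewrite [LHS]mulr_natl mulr2n {2}sym' -big_split/=.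
transitivity (\sum_(k < n.+1) n.+1%:R * (a k * a (n - k)%N)).
  apply: eq_bigr => k _; rewrite -mulrDl; congr (_ * _).
  by rewrite (natrB _ (leq_ord k)) -[n.+1%:R]natr1; lra.
by rewrite -mulr_sumr IHn mulr1.
Qed.

(** In the convolution of index n + 1 the unknown [u n.+1] occurs only in the two end terms, with
    coefficient [u 0 = 1], so it is determined by the earlier values. *)
Lemma arcsine_weight_unique (u : nat -> R) : u 0%N = 1 ->
  (forall n, \sum_(k < n.+1) u k * u (n - k)%N = 1) -> u =1 a.
Proof.
move=> u0 usum n; elim: n {-2}n (leqnn n) => [|n IHn] m.
  by rewrite leqn0 => /eqP ->; rewrite u0 arcsine_weight0.
rewrite leq_eqVlt => /predU1P[->|]; last exact: IHn.
have split (f : nat -> R) : \sum_(k < n.+2) f k * f (n.+1 - k)%N =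
    f 0%N * f n.+1 + \sum_(k < n) f k.+1 * f (n - k)%N + f n.+1 * f 0%N.
  by rewrite big_ord_recr big_ord_recl/= subn0 subnn; congr (_ + _ + _).
have := usum n.+1; rewrite -(sum_arcsine_weight n.+1) !split u0 arcsine_weight0.
rewrite (eq_bigr (fun k : 'I_n => a k.+1 * a (n - k)%N)); first by move=> h;
  lra.
by move=> k _; rewrite !IHn// leq_subr.
Qed.

End arcsine_weight.

(** * The number of positive partial sums of a symmetric walk *)

Section sparre_andersen.
Context {R : realType}.
Variables (nu : set R -> \bar R) (Q : probability (path_space R) R).
Hypothesis iidQ : iid_law nu Q.
Hypothesis nuN : forall D : set R, measurable D -> nu (-%R @^-1` D) = nu D.
Hypothesis psum_neq0 : forall j, Q [set z | psum z j.+1 = 0] = 0%E.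

Let mpsum := @measurable_psum R.

Let measurable_pos n : measurable [set z : path_space R | 0 < psum z n].
Proof. exact: measurable_set_ltr. Qed.

Let measurable_npos n : measurable [set z : path_space R | psum z n <= 0].
Proof. exact: measurable_set_ler. Qed.

Lemma measurable_pos_count n k :
  measurable [set z : path_space R | pos_count n z = k].
Proof.
elim: n k => [|n IHn] k.
  case: k => [|k].
    rewrite (_ : mkset _ = setT)//; apply/seteqP; split=> // z _.
    by rewrite /= /pos_count big_ord0.
  rewrite (_ : mkset _ = set0)//; apply/seteqP; split=> // z /=.
  by rewrite /pos_count big_ord0.
rewrite (_ : mkset _ =
  ([set z | pos_count n z = k] `&` [set z | psum z n.+1 <= 0]) `|`
  ((if k is k'.+1 then [set z | pos_count n z = k'] else set0) `&`
    [set z | 0 < psum z n.+1])).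
  apply: measurableU; apply: measurableI => //.
  by case: k.
apply/seteqP; split=> z /=; rewrite pos_countS.
  case: ltP => S0; rewrite ?addn0 ?addn1.
    by move=> <-; right.
  by move=> ->; left.
case=> -[] + S0; first by rewrite ltNge S0 addn0.
by rewrite S0; case: k => //= k ->; rewrite addn1.
Qed.

Let step (n : nat) (y : path_space R) : path_space R :=
  if 0 < psum y n.+1 then move_to_front n y else y.

Let measurable_move_to_front n :
  measurable_fun setT (move_to_front n : path_space R -> path_space R).
Proof.
apply: measurable_path => i; rewrite /move_to_front.
by case: (i == 0%N); last case: (i <= n)%N; exact: measurable_coord.
Qed.

Let measurable_step n : measurable_fun setT (step n).
Proof.
apply: measurable_fun_ifT => //; first exact: measurable_fun_ltr.
Qed.

(* [move_to_front n] fixes [psum _ n.+1], so it preserves the event that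
   decides whether it is applied. *)
Let law_step n B : measurable B -> Q (step n @^-1` B) = Q B.
Proof.
move=> mB; pose S := [set z : path_space R | 0 < psum z n.+1].
have mS : measurable S by exact: measurable_pos.
have mE : measurable (step n @^-1` B) by exact: measurable_preimageT.
pose mtf : path_space R -> path_space R := move_to_front n.
have split C : measurable C -> Q C = (Q (C `&` S) + Q (C `\` S))%E.
  by move=> mC; rewrite [in LHS](measureDI Q mC mS) addeC.
rewrite (split _ mE) (split _ mB); congr (_ + Q _)%E; last first.
  apply/seteqP; split=> z /= [zB /negP]; rewrite -leNgt => S0; split=> //.
  - by move: zB; rewrite /step ltNge S0.
  - by rewrite /S/= ltNge S0.
  - by rewrite /step ltNge S0.
  - by rewrite /S/= ltNge S0.
rewrite -(iid_move_to_front iidQ n (measurableI _ _ mB mS)); congr (Q _).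
apply/seteqP; split=> z /= [zB]; rewrite /S/= psum_move_to_front_ge// => S0.
  by split=> //; move: zB; rewrite /step S0.
by split=> //; rewrite /step S0.
Qed.

Let reorderS n : (reorder n.+1 : path_space R -> path_space R) =
  step n \o (reorder n : path_space R -> path_space R).
Proof. by apply/funext. Qed.

Let measurable_reorder n :
  measurable_fun setT (reorder n : path_space R -> path_space R).
Proof.
by elim: n => [|n IHn]; [exact: measurable_id|rewrite reorderS; exact:
  measurableT_comp].
Qed.

Lemma iid_reorder n B : measurable B ->
  Q ((reorder n : path_space R -> path_space R) @^-1` B) = Q B.
Proof.
elim: n B => // n IHn B mB; rewrite reorderS comp_preimage IHn ?law_step//.
exact: measurable_preimageT.
Qed.

Definition all_pos n : set (path_space R) :=
  [set z | forall j, (j < n)%N -> 0 < psum z j.+1].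

Let measurable_all_pos n : measurable (all_pos n).
Proof.
rewrite (_ : all_pos n = \bigcap_(j in `I_n) [set z | 0 < psum z j.+1])//.
by apply: bigcap_measurableType.
Qed.

Let all_npos n : set (path_space R) :=
  [set z | forall j, (j < n)%N -> psum z j.+1 <= 0].

Let measurable_all_npos n : measurable (all_npos n).
Proof.
rewrite (_ : all_npos n = \bigcap_(j in `I_n) [set z | psum z j.+1 <= 0])//.
by apply: bigcap_measurableType.
Qed.

Let record n : set (path_space R) :=
  [set z | forall j, (j < n)%N -> psum z j < psum z n].

Let measurable_record n : measurable (record n).
Proof.
rewrite (_ : record n = \bigcap_(j in `I_n) [set z | psum z j < psum z n])//.
by apply: bigcap_measurableType => j _; exact: measurable_set_ltr.
Qed.

Let psum_rev k z j : (j <= k)%N ->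
  psum (path_rev k z) j = psum z k - psum z (k - j)%N :> R.
Proof.
elim: j => [|j IHj] jk; first by rewrite subn0 subrr psum0.
rewrite psumS IHj ?(ltnW jk)// /path_rev jk.
have -> : (k - j = (k - j.+1).+1)%N by lia.
rewrite psumS (_ : (k.-1 - j)%N = (k - j.+1)%N); last by lia.
by rewrite opprD addrA subrK.
Qed.

(** Time reversal: the partial sums of the reversed steps are the differences between the last value
    of the walk and its earlier values. *)
Let law_record k : Q (record k) = Q (all_pos k).
Proof.
rewrite -(iid_rev iidQ k (measurable_all_pos k)); congr (Q _).
apply/seteqP; split=> z /= h j jk.
  by rewrite psum_rev// subr_gt0 h//; lia.
have kj : (k - (k - j.+1).+1)%N = j by lia.
have := h (k - j.+1)%N; rewrite psum_rev ?kj ?subr_gt0; last by lia.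
by apply; lia.
Qed.

(** Reflection turns nonpositive sums into nonnegative ones; these differ from positive ones only on
    the null event that some partial sum vanishes. *)
Let law_all_npos n : Q (all_npos n) = Q (all_pos n).
Proof.
rewrite -(iid_opp iidQ nuN (measurable_all_npos n)).
set B := (X in Q X = _).
have BE : B = [set z | forall j, (j < n)%N -> 0 <= psum z j.+1].
  by apply/seteqP; split=> z h j jn; have := h j jn;
    rewrite /= (psumN (z : nat -> R)) oppr_le0.
have mB : measurable B.
  rewrite BE (_ : mkset _ = \bigcap_(j in `I_n) [set z | 0 <= psum z j.+1])//.
  by apply: bigcap_measurableType => j _; exact: measurable_set_ler.
pose Z := \bigcup_j [set z : path_space R | psum z j.+1 = 0].
have mZ0 j : measurable [set z : path_space R | psum z j.+1 = 0].
  rewrite (_ : mkset _ = (fun z : path_space R => psum z j.+1) @^-1` [set 0])//.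
  exact: measurable_preimageT.
have Z0 : Q.-negligible Z.
  by apply: negligible_bigcup => j; apply/negligibleP; [exact: mZ0|exact:
    psum_neq0].
have mZ : measurable Z by exact: bigcupT_measurable.
have {}Z0 : Q Z = 0%E by apply/negligibleP.
have h C : measurable C -> Q C = Q (C `\` Z).
  move=> mC; rewrite [in LHS](measureDI Q mC mZ) addeC (@subset_measure0 _ _ _
    Q _ Z) ?add0e//.
  exact: measurableI.
rewrite (h _ mB) (h _ (measurable_all_pos n)) BE; congr (Q _).
apply/seteqP; split=> z /= [zh zZ]; split=> // j jn; last exact/ltW/zh.
by rewrite lt_neqAle zh// andbT eq_sym; apply/eqP => zj; apply: zZ; exists j.
Qed.

Let psum_trunc k (z : path_space R) j :
  (j <= k)%N -> psum (path_trunc k z) j = psum z j.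
Proof.
by move=> jk; apply: eq_psum => i ij; rewrite /path_trunc (leq_trans ij).
Qed.

(** The condition to the left of [k] involves only the first [k] steps and the condition to the
    right only the later ones, which is the form that independence requires. *)
Let first_maxE n k : (k <= n)%N ->
  [set z : path_space R | first_max n k z] =
  path_trunc k @^-1` record k `&` path_shift k @^-1` all_npos (n - k).
Proof.
move=> kn.
apply/seteqP; split=> z /=.
  move=> [_ h1 h2]; split.
    by move=> j jk; rewrite (psum_trunc _ (ltnW jk)) (psum_trunc _ (leqnn k))
      h1.
  move=> j jnk; have := h2 (k + j.+1)%N.
  by rewrite psumD gerDl leq_addr/=; apply; lia.
move=> [h1 h2]; split=> //.
  by move=> j jk; have := h1 j jk; rewrite (psum_trunc _ (ltnW jk)) (psum_trunc
    _ (leqnn k)).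
move=> j /andP[]; rewrite leq_eqVlt => /predU1P[->//|kj] jn.
rewrite (_ : j = k + (j - k).-1.+1)%N; last by lia.
by rewrite psumD gerDl; apply: h2; lia.
Qed.

Lemma pos_count_law n k : (k <= n)%N ->
  Q [set z | pos_count n z = k] = (Q (all_pos k) * Q (all_pos (n - k)))%E.
Proof.
move=> kn.
rewrite -law_record -law_all_npos.
have -> : Q (record k) = Q (path_trunc k @^-1` record k).
  congr (Q _); apply/seteqP; split=> z /= h j jk; have := h j jk;
    by rewrite (psum_trunc _ (ltnW jk)) (psum_trunc _ (leqnn k)).
rewrite -(iid_indep iidQ)// -first_maxE//.
have mfm : measurable [set z : path_space R | first_max n k z].
  by rewrite first_maxE//; apply: measurableI; apply: measurable_preimageT =>
    //;
    [exact: measurable_path_trunc|exact: measurable_path_shift].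
(* The count event is the preimage under [reorder n] of the event about the leftmost maximum;
   uniqueness of its index gives the reverse inclusion. *)
rewrite -(iid_reorder n mfm); congr (Q _).
apply/seteqP; split=> z /=; first by move=> <-; exact: first_max_reorder.
exact/first_max_uniq/first_max_reorder.
Qed.

(** The events that the count equals k, for k up to n, partition the space, so the unknown
    probabilities satisfy the convolution identity that characterises the arcsine weights. The step
    law thus never enters explicitly. *)
Lemma all_pos_law n : Q (all_pos n) = (arcsine_weight n)%:E.
Proof.
have Qf B : measurable B -> Q B = (fine (Q B))%:E.
  by move=> mB; rewrite fineK// fin_num_measure.
rewrite Qf//; congr (_ %:E); move: n.
apply: arcsine_weight_unique => [|n].
  rewrite (_ : all_pos 0 = setT) ?probability_setT//.
  by apply/seteqP; split.
apply: EFin_inj; rewrite -sumEFin.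
pose F k : set (path_space R) := [set z | pos_count n z = k].
have FT : setT = \big[setU/set0]_(k < n.+1) F k.
  apply/esym/seteqP; split=> // z _; rewrite -(bigcup_mkord n.+1 F).
  by exists (pos_count n z) => //=; rewrite ltnS pos_count_le.
rewrite -(probability_setT Q) FT measure_semi_additive_ord_I//.
- apply: eq_bigr => k _.
  by rewrite EFinM -!Qf//; apply/esym; exact: pos_count_law (leq_ord k).
- by move=> k _; exact: measurable_pos_count.
- by apply/trivIsetP => i j _ _ /eqP ij; apply/seteqP; split=> // z [zi zj];
  apply: ij; rewrite -zi -zj.
- by rewrite -FT.
Qed.

(** Induction on [k]. Write p_n(k) for the probability that the count up to n is k, and E(k) for the
    probability sought. The sign of the last sum decides whether the count grows, so splitting both
    p_n(k) and p_(n+1)(k) by that sign gives E(k + 1) = p_n(k) - (p_(n+1)(k) - E(k)). *)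
Lemma pos_count_end_law n k : (k <= n.+1)%N ->
  Q [set z | pos_count n.+1 z = k /\ 0 < psum z n.+1] =
  (k%:R / n.+1%:R * (arcsine_weight k * arcsine_weight (n.+1 - k)))%:E.
Proof.
pose Ep i j m := [set z : path_space R | pos_count i z = j /\ 0 < psum z m].
pose En i j m := [set z : path_space R | pos_count i z = j /\ psum z m <= 0].
have mEp i j m : measurable (Ep i j m).
  exact: (measurableI _ _ (measurable_pos_count i j) (measurable_pos m)).
have mEn i j m : measurable (En i j m).
  exact: (measurableI _ _ (measurable_pos_count i j) (measurable_npos m)).
have split i j m :
    (Q [set z | pos_count i z = j] = Q (Ep i j m) + Q (En i j m))%E.
  rewrite -measureU//.
    congr (Q _); apply/seteqP; split=> z /=; last by case=> -[].
    by move=> zj; case: (ltP 0 (psum z m)) => S0; [left|right].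
  by apply/seteqP; split=> // z /= [[_ S0] [_]]; rewrite leNgt S0.
rewrite -/(Ep n.+1 k n.+1); elim: k => [_|k IHk kn].
  rewrite !mul0r (_ : Ep _ _ _ = set0) ?measure0//.
  by apply/seteqP; split=> // z /= []; rewrite pos_countS => /[swap] ->;
    rewrite addn1.
have Q1 := split n k n.+1; have Q2 := split n.+1 k n.+1.
have EnS : En n.+1 k n.+1 = En n k n.+1.
  by apply/seteqP; split=> z /= []; rewrite /En/= pos_countS ltNge => /[swap]
    S0;
    rewrite S0 addn0.
have EpS : Ep n k n.+1 = Ep n.+1 k.+1 n.+1.
  apply/seteqP; split=> z /= []; rewrite /Ep/= pos_countS => /[swap] S0;
    rewrite S0 addn1; first by move=> ->.
  by case=> ->.
rewrite EnS IHk ?(ltnW kn)// in Q2; rewrite EpS in Q1; move: Q1 Q2.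
rewrite !pos_count_law ?all_pos_law//; last exact: ltnW.
have QpE := fineK (fin_num_measure Q _ (mEp n.+1 k.+1 n.+1)).
have QnE := fineK (fin_num_measure Q _ (mEn n k n.+1)).
rewrite -QpE -QnE -!EFinM -!EFinD => -[Q1] [Q2]; congr (_ %:E).
have n0 : n.+1%:R != 0 :> R by rewrite pnatr_eq0.
have kn' : (k <= n)%N by [].
have cE := @arcsine_weightS R k; have bE := @arcsine_weightS R (n - k).
move: bE; rewrite -subSn// subSS natrB// => bE.
set b := arcsine_weight (n.+1 - k) in Q2 bE *.
set b' := arcsine_weight (n - k) in Q1 bE *.
set c := arcsine_weight k in Q1 Q2 cE; set c' := arcsine_weight k.+1 in cE *.
have Q3 : n.+1%:R * (c * b) = k%:R * (c * b) + n.+1%:R * fine (Q (En n k n.+1)).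
  by rewrite {1}Q2 mulrDr; congr (_ + _); field; rewrite ?nat1r ?natr1
    ?pnatr_eq0.
(* By [Q3] and [bE] the subtracted part is (n - k + 1/2) c b', so the left side is (k + 1/2) c b',
   which is (k + 1) c' b' by [cE]. *)
have : n.+1%:R * fine (Q (Ep n.+1 k.+1 n.+1)) = k.+1%:R * (c' * b').
  rewrite -!natr1 in Q3 *.
  have := congr1 ( *%R c) bE; have := congr1 ( *%R b') cE.
  by have := congr1 ( *%R (n%:R + 1)) Q1; lra.
by move=> h; apply: (mulfI n0); rewrite h; field; rewrite ?nat1r ?natr1
  ?pnatr_eq0.
Qed.

End sparre_andersen.

(** * Wallis integrals and Bernstein polynomials *)

Section wallis.
Context {R : realType}.
Notation mu := (@lebesgue_measure R).
Notation a := (@arcsine_weight R).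
Implicit Type f g : R -> R.

Definition quarter_int f : R := \int[mu]_(x in `[0, pi / 2]) f x.
Notation J := quarter_int.

Lemma integrable_quarter f : continuous f ->
  mu.-integrable `[0, pi / 2] (EFin \o f).
Proof.
move=> cf; apply: continuous_compact_integrable; first exact: segment_compact.
exact: continuous_subspaceT.
Qed.

Lemma quarter_intD f g : continuous f -> continuous g ->
  J (fun x => f x + g x) = J f + J g.
Proof. by move=> cf cg; apply: RintegralD => //; exact: integrable_quarter. Qed.

Lemma quarter_intZ c f : continuous f -> J (fun x => c * f x) = c * J f.
Proof. by move=> cf; apply: RintegralZl => //; exact: integrable_quarter. Qed.

Lemma quarter_int_sum n (F : 'I_n -> R -> R) : (forall i, continuous (F i)) ->
  J (fun x => \sum_(i < n) F i x) = \sum_(i < n) J (F i).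
Proof.
elim: n F => [|n IHn] F cF.
  rewrite big_ord0 /J; under eq_Rintegral do rewrite big_ord0.
  by rewrite Rintegral_cst// mul0r.
rewrite big_ord_recr/= -IHn// -quarter_intD//.
  by congr J; apply/funext => x; rewrite big_ord_recr.
by apply: (continuous_big (op := +%R)) => [|i _]; [exact: add_continuous|exact:
  cF].
Qed.

Lemma quarter_int_derive (F f : R -> R) :
  (forall x : R, is_derive x (1 : R) F (f x)) -> continuous f -> J f = F (pi /
    2) - F 0.
Proof.
move=> dF cf; have pi2 : (0 : R) < pi / 2 by rewrite divr_gt0// pi_gt0.
have cF : continuous F.
  by move=> x; apply/differentiable_continuous/derivable1_diffP; case: (dF x).
rewrite /J /Rintegral (@continuous_FTC2 _ f F)//.
- exact: continuous_subspaceT.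
- split; first by move=> x _; case: (dF x).
    by apply: cvg_at_right_filter; exact: cF.
  by apply: cvg_at_left_filter; exact: cF.
- by move=> x _; rewrite derive1E; case: (dF x).
Qed.

Lemma continuous_sin_pow k j :
  continuous (fun x : R => (sin x ^+ 2) ^+ k * (1 - sin x ^+ 2) ^+ j).
Proof.
have cX (f : R -> R) n : continuous f -> continuous (fun x => f x ^+ n).
  by move=> cf x; apply: (cvg_comp _ (fun y : R => y ^+ n)); [exact: cf|exact:
    exprn_continuous].
have cs := cX _ 2%N (@continuous_sin R).
move=> x; apply: cvgM; first exact: (cX _ k cs x).
apply: (cX (fun y => 1 - sin y ^+ 2) j _ x) => y.
by apply: cvgB; [exact: cvg_cst|exact: cs].
Qed.

(** Half the Beta value B(k + 1/2, j + 1/2). The cosine is written as [1 - sin x ^+ 2] so that the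
    integrand is literally a Bernstein monomial at [sin x ^+ 2]. *)
Definition quarter_moment k j : R :=
  J (fun x => (sin x ^+ 2) ^+ k * (1 - sin x ^+ 2) ^+ j).
Notation M := quarter_moment.

Let M_split k j : M k j = M k.+1 j + M k j.+1.
Proof.
rewrite /M -quarter_intD; [|exact: continuous_sin_pow..].
by congr J; apply/funext => x; rewrite !exprS; ring.
Qed.

(** Integrate the derivative of 1/2 sin^(2k+1) cos^(2j+1), a function that vanishes at both ends of
    the interval. *)
Let M_parts k j : (k%:R + 2^-1) * M k j.+1 = (j%:R + 2^-1) * M k.+1 j.
Proof.
apply/eqP; rewrite -subr_eq0 -mulNr /M -!quarter_intZ;
  [|exact: continuous_sin_pow..].
rewrite -quarter_intD; last 2 first.
- by move=> x; apply: cvgM; [exact: cst_continuous|exact: continuous_sin_pow].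
- by move=> x; apply: cvgM; [exact: cst_continuous|exact: continuous_sin_pow].
pose F : R -> R :=
  2^-1 *: ((@sin R) ^+ (2 * k).+1 * (@cos R) ^+ (2 * j).+1 : R -> R^o).
have FE x : F x = 2^-1 * (sin x ^+ (2 * k).+1 * cos x ^+ (2 * j).+1).
  by rewrite /F !fctE.
apply/eqP; transitivity (F (pi / 2) - F 0); last first.
  by rewrite !FE sin0 cos_pihalf !expr0n/= mulr0 mul0r !mulr0 subrr.
apply: quarter_int_derive => x.
  rewrite /F; apply: is_derive_eq; rewrite /= fctE /GRing.scale/=.
  have nat2 n : (2 * n).+1%:R = 2 * n%:R + 1 :> R by rewrite -natr1 natrM.
  rewrite -cos2sin2 !nat2 !fctE ![_ ^+ (2 * _).+1]exprS ![_ ^+ k.+1]exprS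
    ![_ ^+ j.+1]exprS !exprM.
  by move: (sin x ^+ 2 ^+ k) (cos x ^+ 2 ^+ j) => p q; field.
apply: cvgD; (apply: cvgM; [exact: cvg_cst|exact: continuous_sin_pow]).
Qed.

Lemma quarter_momentE n k : (k <= n)%N ->
  'C(n, k)%:R * M k (n - k) = pi / 2 * (a k * a (n - k)).
Proof.
move=> kn; have <- : (k + (n - k) = n)%N by rewrite subnKC.
rewrite addKn; move: (n - k)%N => j {n kn}.
elim: k => [|k IHk].
  rewrite bin0 mul1r; elim: j => [|j IHj].
    rewrite /M (_ : (fun _ => _) = cst 1); last by apply/funext => x; rewrite
      !expr0 mulr1.
    rewrite /J Rintegral_cst//= lebesgue_measure_itv/= lte_fin divr_gt0
      ?pi_gt0//.
    by rewrite arcsine_weight0 oppr0 addr0 mul1r !mulr1.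
  have j0 : j%:R + 1 != 0 :> R by rewrite natr1 pnatr_eq0.
  apply: (mulfI j0); move: IHj; rewrite arcsine_weight0 !mul1r => IHj.
  have := arcsine_weightS (R := R) j; have := M_split 0 j; have := M_parts 0 j.
  move=> h1 h2 h3; have := congr1 ( *%R (j%:R + 2^-1)) h2.
  have := congr1 ( *%R (j%:R + 2^-1)) IHj; have := congr1 ( *%R (pi / 2)) h3.
  lra.
have k0 : k%:R + 1 != 0 :> R by rewrite natr1 pnatr_eq0.
have kj0 : k%:R + j%:R + 1 != 0 :> R by rewrite -natrD natr1 pnatr_eq0.
(* Eliminating [M k j.+1] between [M_split] and [M_parts] leaves a recursion in [k] alone. *)
have MS : (k%:R + j%:R + 1) * M k.+1 j = (k%:R + 2^-1) * M k j.
  by have := M_parts k j; rewrite (M_split k j); lra.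
have CS : (k%:R + 1) * 'C(k.+1 + j, k.+1)%:R = (k%:R + j%:R + 1) * 'C(k + j,
  k)%:R :> R.
  by rewrite natr1 -natrD natr1 -!natrM addSn mul_bin_diag.
have := congr1 (fun y => y * M k.+1 j) CS.
have := congr1 ( *%R 'C(k + j, k)%:R) MS.
have := congr1 ( *%R (k%:R + 2^-1)) IHk.
have := congr1 (fun y => pi / 2 * (y * a j)) (arcsine_weightS (R := R) k).
by move=> /= h1 h2 h3 h4; apply: (mulfI k0); lra.
Qed.

End wallis.

(** * Bernstein approximation and the limit of arcsine sums *)

Section bernstein.
Context {R : realType}.
Implicit Types (f g : nat -> R) (h : R -> R) (y : R).

Definition bernstein n f y : R :=
  \sum_(k < n.+1) f k * ('C(n, k)%:R * (y ^+ k * (1 - y) ^+ (n - k))).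

(** [bernstein n f y] is the expectation of [f] at a binomial variable with parameters [n] and [y];
    this conditions on one of the trials. *)
Lemma bernsteinS n f y : bernstein n.+1 f y =
  y * bernstein n (fun k => f k.+1) y + (1 - y) * bernstein n f y.
Proof.
transitivity (y * bernstein n (fun k => f k.+1) y +
    \sum_(k < n.+2) f k * ('C(n, k)%:R * (y ^+ k * (1 - y) ^+ (n.+1 - k)))).
  rewrite /bernstein big_ord_recl [X in _ = _ + X]big_ord_recl/= !bin0 addrCA.
  congr (_ + _); rewrite mulr_sumr -big_split/=; apply: eq_bigr => k _.
  by rewrite /bump leq0n add1n subSS binS natrD exprS; ring.
congr (_ + _); rewrite big_ord_recr/= bin_small// mul0r mulr0 addr0.
rewrite /bernstein mulr_sumr; apply: eq_bigr => k _.
by rewrite (subSn (leq_ord k)) exprS; ring.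
Qed.

Lemma bernstein_cst n c y : bernstein n (fun=> c) y = c.
Proof.
elim: n => [|n IHn].
  by rewrite /bernstein big_ord_recl big_ord0 /= bin0 subnn !expr0 !mulr1 addr0.
by rewrite bernsteinS IHn; ring.
Qed.

Lemma bernstein_affine n f b c y :
  bernstein n (fun k => b + c * f k) y = b + c * bernstein n f y.
Proof.
rewrite -[in RHS](bernstein_cst n b y) /bernstein mulr_sumr -big_split/=.
by apply: eq_bigr => k _; ring.
Qed.

(** The centre [c] is arbitrary because the induction step replaces it by [c - 1]; the case of
    interest is [c = n%:R * y]. *)
Lemma bernstein_variance n c y :
  bernstein n (fun k => (k%:R - c) ^+ 2) y =
  n%:R * (y * (1 - y)) + (n%:R * y - c) ^+ 2.
Proof.
elim: n c => [|n IHn] c.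
  rewrite /bernstein big_ord_recl big_ord0 /= bin0 subnn !expr0.
  by ring.
rewrite bernsteinS IHn -natr1.
have -> : bernstein n (fun k => (k.+1%:R - c) ^+ 2) y =
          bernstein n (fun k => (k%:R - (c - 1)) ^+ 2) y.
  by apply: eq_bigr => k _; rewrite -natr1; congr (_ ^+ 2 * _); ring.
by rewrite IHn; ring.
Qed.

Lemma le_bernstein n f g y : 0 <= y <= 1 ->
  (forall k, (k <= n)%N -> f k <= g k) -> bernstein n f y <= bernstein n g y.
Proof.
move=> /andP[y0 y1] fg; apply: ler_sum => k _.
apply: ler_wpM2r; last by apply: fg; rewrite -ltnS.
by rewrite !mulr_ge0// exprn_ge0// subr_ge0.
Qed.

(** The bound does not depend on [y], so it survives integration over the angle. The parameter
    [delta] is free and is later tuned to the required precision. *)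
Lemma bernstein_dist n h K (delta : R) y : (0 < n)%N -> 0 <= K -> 0 < delta ->
  0 <= y <= 1 ->
  (forall u v, 0 <= u <= 1 -> 0 <= v <= 1 -> `|h u - h v| <= K * `|u - v|) ->
  `|bernstein n (fun k => h (k%:R / n%:R)) y - h y| <=
  K / 2 * (delta + (delta * n%:R)^-1).
Proof.
move=> n0 K0 d0 y01 hK.
have n0' : 0 < n%:R :> R by rewrite ltr0n.
(* The coefficient of the quadratic term below, once the deviation u is rewritten as (k - n y) /
   n. *)
pose c := K / (2 * delta * n%:R ^+ 2).
(* [|u| <= (delta + u^2 / delta) / 2] *)
have amgm k : (k <= n)%N -> `|h (k%:R / n%:R) - h y| <=
    K / 2 * delta + c * (k%:R - n%:R * y) ^+ 2.
  move=> kn; apply: (le_trans (hK _ _ _ y01)).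
    by rewrite divr_ge0// ler_pdivrMr// mul1r ler_nat.
  set u := _ / _ - y.
  have -> : k%:R - n%:R * y = n%:R * u.
    by rewrite /u mulrBr mulrCA divff ?mulr1 ?gt_eqF.
  have -> : K / 2 * delta + c * (n%:R * u) ^+ 2 =
      K * ((delta ^+ 2 + `|u| ^+ 2) / (2 * delta)).
    rewrite real_normK ?num_real// /c; field.
    by rewrite !gt_eqF.
  rewrite ler_wpM2l// ler_pdivlMr ?mulr_gt0//.
  have := sqr_ge0 (delta - `|u|); nra.
have vB : bernstein n (fun k => (k%:R - n%:R * y) ^+ 2) y <= n%:R.
  rewrite bernstein_variance subrr expr0n addr0 ler_piMr//.
  by case/andP: y01 => y0 y1; nra.
have cE : K / 2 * (delta + (delta * n%:R)^-1) = K / 2 * delta + c * n%:R.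
  by rewrite /c; field; rewrite !gt_eqF.
have c0 : 0 <= c by rewrite divr_ge0// !mulr_ge0// ?exprn_ge0// ltW.
have cvB := ler_wpM2l c0 vB.
rewrite ler_norml cE; apply/andP; split.
  rewrite lerBrDl; apply: (@le_trans _ _ (h y - K / 2 * delta +
     - c * bernstein n (fun k => (k%:R - n%:R * y) ^+ 2) y)); first by lra.
  rewrite -bernstein_affine; apply: le_bernstein => // k kn.
  by have := amgm k kn; rewrite ler_norml => /andP[+ _]; lra.
rewrite lerBlDr; apply: (@le_trans _ _ (h y + K / 2 * delta +
   c * bernstein n (fun k => (k%:R - n%:R * y) ^+ 2) y)); last by lra.
rewrite -bernstein_affine; apply: le_bernstein => // k kn.
by have := amgm k kn; rewrite ler_norml => /andP[_ +]; lra.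
Qed.

Notation a := (@arcsine_weight R).

Lemma arcsine_weight_bernstein n f :
  \sum_(k < n.+1) f k * (a k * a (n - k)%N) =
  2 / pi * quarter_int (fun x => bernstein n f (sin x ^+ 2)).
Proof.
have pi0 : pi != 0 :> R by rewrite gt_eqF// pi_gt0.
have cM k j (c : R) : continuous (fun x : R =>
    c * ((sin x ^+ 2) ^+ k * (1 - sin x ^+ 2) ^+ j)).
  by move=> x; apply: cvgM; [exact: cvg_cst|exact: continuous_sin_pow].
rewrite /bernstein quarter_int_sum; last first.
  move=> k x; apply: cvgM; [exact: cvg_cst|exact: cM].
rewrite mulr_sumr; apply: eq_bigr => k _.
rewrite quarter_intZ ?quarter_intZ//; last first.
  exact: continuous_sin_pow.
have := quarter_momentE (R := R) (leq_ord k); rewrite /quarter_moment => ->.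
by move: pi pi0 => p p0; field.
Qed.

Lemma arcsine_limit h K : continuous h -> 0 <= K ->
  (forall u v, 0 <= u <= 1 -> 0 <= v <= 1 -> `|h u - h v| <= K * `|u - v|) ->
  (\sum_(k < n.+2) h (k%:R / n.+1%:R) * (a k * a (n.+1 - k)%N)) @[n --> \oo]
    --> 2 / pi * quarter_int (fun x => h (sin x ^+ 2)).
Proof.
move=> ch K0 hK.
have s01 (x : R) : 0 <= sin x ^+ 2 <= 1.
  by rewrite sqr_ge0/= sin2cos2 gerBl sqr_ge0.
have chs : continuous (fun x : R => h (sin x ^+ 2)).
  move=> x; apply: (cvg_comp _ h); last exact: ch.
  by apply: (cvg_comp _ (fun y : R => y ^+ 2));
    [exact: continuous_sin|exact: exprn_continuous].
have cB n f : continuous (fun x : R => bernstein n f (sin x ^+ 2)).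
  apply: (continuous_big (op := +%R)) => [|k _]; first exact: add_continuous.
  move=> x; apply: cvgM; first exact: cvg_cst.
  by apply: cvgM; [exact: cvg_cst|exact: continuous_sin_pow].
have pi0 : 0 < pi :> R by exact: pi_gt0.
apply/cvgrPdist_le => /= e e0.
have K1 : 0 < K + 1 by rewrite ltr_wpDl.
(* For large n the error bound is at most [K * delta]. Dividing by [K + 1] covers [K = 0], and the
   length [pi / 2] of the interval cancels the prefactor [2 / pi]. *)
have [delta dE d0] : exists2 delta, delta = e / (K + 1) & 0 < delta.
  by exists (e / (K + 1)); rewrite ?divr_gt0.
have n0 : \forall n \near \oo, (delta * n.+1%:R)^-1 <= delta :> R.
  near=> n; rewrite invf_ple ?posrE// ?mulr_gt0//.
  rewrite mulrC -ler_pdivrMr// -natr1 (@le_trans _ _ n%:R)// ?lerDl//.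
  near: n; exact: nbhs_infty_ger.
near=> n; rewrite (arcsine_weight_bernstein n.+1 (fun k => h (k%:R / n.+1%:R))).
have dn : (delta * n.+1%:R)^-1 <= delta by near: n.
rewrite -mulrBr normrM ger0_norm ?divr_ge0//; last exact: ltW.
set F := (fun x => h _); set G := (fun x => bernstein _ _ _).
have iFG : lebesgue_measure.-integrable `[0, pi / 2] (EFin \o (fun x => F x - G
  x)).
  by apply: integrable_quarter => x; apply: cvgB; [exact: chs|exact: cB].
rewrite /quarter_int -RintegralB//; last 2 first.
- exact: integrable_quarter.
- by apply: integrable_quarter; exact: cB.
have bnd : \int[lebesgue_measure]_(x in `[0, pi / 2]) `|F x - G x| <=
    \int[lebesgue_measure]_(x in `[0, pi / 2]) (K * delta).
  apply: le_Rintegral => //.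
  - by apply: integrable_quarter => x; apply: cvg_norm; apply: cvgB; [exact:
    chs|exact: cB].
  - by apply: integrable_quarter => x; exact: cvg_cst.
  - move=> x _; rewrite distrC; apply: (le_trans (bernstein_dist _ K0 d0 (s01
    x) hK)) => //.
    by rewrite -mulrA ler_wpM2l// ler_pdivrMl// mulr_natl mulr2n lerD2l.
have cK : K * delta <= e.
  by rewrite dE mulrA ler_pdivrMr// mulrC ler_wpM2l ?lerDl// ltW.
apply: (@le_trans _ _ (2 / pi * (pi / 2 * e))); last first.
  by rewrite mulrA mulf_div [pi * 2]mulrC divff ?mul1r// mulf_neq0// gt_eqF.
rewrite ler_wpM2l//; first by rewrite divr_ge0// ltW.
apply: (le_trans (le_normr_Rintegral _ iFG)) => //.
apply: (le_trans bnd); rewrite Rintegral_cst//= lebesgue_measure_itv/= lte_fin.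
rewrite divr_gt0//= oppr0 addr0.
by rewrite mulrC ler_wpM2l//; apply: divr_ge0 => //; exact: ltW.
Unshelve. all: by end_near. Qed.

End bernstein.

(** * Brownian motion on a grid *)

Section brownian_grid.
Context d (T : measurableType d) (R : realType) (P : probability T R).
Variable x : R -> {RV P >-> R}.
Hypothesis hx : standard_brownian_motion P x.
Variables (h : R) (h_gt0 : 0 < h).

Definition grid_step (w : T) : path_space R :=
  fun i => x (i.+1%:R * h) w - x (i%:R * h) w.

Lemma measurable_grid_step : measurable_fun setT grid_step.
Proof. by apply: measurable_path => i; apply: measurable_funB. Qed.

Lemma psum_grid_step w n : psum (grid_step w) n = x (n%:R * h) w.
Proof.
elim: n => [|n IHn]; first by rewrite psum0 mul0r (sbm_start hx).
by rewrite psumS IHn /grid_step subrKC.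
Qed.

Definition grid_law : {mfun T >-> path_space R} :=
  mfun_Sub (mem_set measurable_grid_step).

Lemma iid_grid : iid_law (normal_prob 0 (Num.sqrt h)) (distribution P grid_law).
Proof.
split=> [|m A mA]; first exact: probability_setT.
have nd : nondecreasing_seq (fun n : nat => n%:R * h).
  by move=> i j ij; rewrite ler_pM2r// ler_nat.
have h0 : 0 <= (0%:R : R) * h by rewrite mul0r.
have := sbm_independent_increments hx (n := m) h0 nd (A := fun i => A i) (fun i
  => mA i).
rewrite (_ : \bigcap_i _ = grid_law @^-1` cylinder m A); last first.
  apply/seteqP; split=> w /=.
    by move=> wA i im; exact: (wA (Ordinal im) I).
  by move=> wA i _; exact: wA.
move=> /esym PA; apply: (eq_trans (esym PA)); apply: eq_bigr => i _.
have ih : 0 <= i%:R * h by rewrite mulr_ge0// ltW.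
have ih1 : i%:R * h < i.+1%:R * h by rewrite ltr_pM2r// ltr_nat.
have := sbm_gaussian_increments hx ih ih1 (mA i).
by rewrite -[X in Num.sqrt X]mulrBl -natr1 [_ + 1]addrC addrK mul1r.
Qed.

End brownian_grid.

Section brownian_law.
Context d (T : measurableType d) (R : realType) (P : probability T R).
Variable x : R -> {RV P >-> R}.
Hypothesis hx : standard_brownian_motion P x.

Lemma normal_prob_opp (s : R) (D : set R) : s != 0 -> measurable D ->
  normal_prob 0 s (-%R @^-1` D) = normal_prob 0 s D :> \bar R.
Proof.
move=> s0 mD; rewrite /normal_prob.
pose f y := (normal_pdf 0 s y)%:E.
have fN y : f (- y) = f y.
  by rewrite /f !normal_pdfE// /normal_fun !subr0 sqrrN.
have mf : measurable_fun D f.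
  by apply/measurable_funTS/measurable_EFinP; exact: measurable_normal_pdf.
transitivity (\int[pushforward (@lebesgue_measure R)
    (-%R : _ -> measurableTypeR R)]_(y in D) f y)%E; last first.
  by apply: eq_measure_integral => //= A mA AS; exact/lebesgue_measureN.
rewrite ge0_integral_pushforward//=.
  by apply: eq_integral => y _; apply/esym; exact: fN.
by move=> y _; rewrite /f lee_fin normal_pdf_ge0.
Qed.

Lemma brownian_eq0 (s : R) : 0 < s -> P [set w | x s w = 0] = 0%E.
Proof.
move=> s0.
have := sbm_gaussian_increments hx (lexx 0) s0 (measurable_set1 0).
rewrite (_ : _ @^-1` _ = [set w | x s w = 0]); last first.
  by apply/seteqP; split=> w /=; rewrite (sbm_start hx) subr0.
move=> ->; have /null_content_dominatesP := @normal_prob_dominates R 0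
  (Num.sqrt (s - 0)).
by apply => //; exact: lebesgue_measure_set1.
Qed.
End brownian_law.

Section grid_count.
Context d (T : measurableType d) (R : realType) (P : probability T R).
Variable x : R -> {RV P >-> R}.
Hypothesis hx : standard_brownian_motion P x.
Variables (t : R) (t_gt0 : 0 < t).
Notation a := (@arcsine_weight R).

(** The index [n] stands for n + 1 cells, so the mesh is never a division by zero. *)
Definition grid_count (n : nat) (w : T) : nat :=
  pos_count n.+1 (grid_step x (t / n.+1%:R) w).

Definition end_pos : set T := [set w | 0 < x t w].

Lemma measurable_end_pos : measurable end_pos.
Proof. exact: measurable_set_ltr. Qed.

Let step_gt0 n : 0 < t / n.+1%:R. Proof. by rewrite divr_gt0. Qed.

Let measurable_grid_count n k : measurable [set w | grid_count n w = k].
Proof.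
exact: (measurable_preimageT (measurable_grid_step x (t / n.+1%:R))
  (measurable_pos_count n.+1 k)).
Qed.

Lemma grid_count_law n k : (k <= n.+1)%N ->
  P ([set w | grid_count n w = k] `&` end_pos) =
  (k%:R / n.+1%:R * (a k * a (n.+1 - k)))%:E.
Proof.
move=> kn; have h0 := step_gt0 n.
have s0 : Num.sqrt (t / n.+1%:R) != 0 by rewrite gt_eqF// sqrtr_gt0.
have nz j : distribution P (grid_law x (t / n.+1%:R)) [set z | psum z j.+1 = 0]
  = 0%E.
  rewrite -[LHS]/(P [set w | psum (grid_step x (t / n.+1%:R) w) j.+1 = 0]).
  rewrite (_ : [set w | _] = [set w | x (j.+1%:R * (t / n.+1%:R)) w = 0]).
    by apply: (brownian_eq0 hx); rewrite mulr_gt0.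
  by apply/seteqP; split=> w /=; rewrite (psum_grid_step hx).
have := pos_count_end_law (iid_grid hx h0) (fun D => normal_prob_opp s0) nz kn.
move=> <-; congr (P _); apply/seteqP; split=> w; rewrite /=.
  by move=> [wk xt]; split=> //; rewrite (psum_grid_step hx) mulrC divfK.
by move=> [wk]; rewrite (psum_grid_step hx) mulrC divfK.
Qed.

Lemma grid_count_le n w : (grid_count n w <= n.+1)%N.
Proof. exact: pos_count_le. Qed.

Lemma integral_grid_count (g : R -> R) n :
  (\int[P]_(w in end_pos) (g ((grid_count n w)%:R / n.+1%:R))%:E =
   (\sum_(k < n.+2) g (k%:R / n.+1%:R) * (k%:R / n.+1%:R) *
      (a k * a (n.+1 - k)%N))%:E)%E.
Proof.
pose A k := [set w | grid_count n w = k].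
transitivity (\int[P]_(w in end_pos)
    (\sum_(k < n.+2) (g (k%:R / n.+1%:R))%:E * (\1_(A k) w)%:E))%E.
  apply: eq_integral => w _.
  have cn : (grid_count n w < n.+2)%N by rewrite ltnS grid_count_le.
  rewrite (bigD1 (Ordinal cn))//= indicE mem_set// mule1 big1 ?adde0// => k.
  move=> /eqP kE; rewrite indicE memNset ?mule0// => wk; apply: kE.
  exact/val_inj/esym.
have mA k : measurable (A k) by exact: measurable_grid_count.
have iA k : P.-integrable end_pos (fun w => (\1_(A k) w)%:E).
  apply: (integrableS measurableT measurable_end_pos) => //.
  exact: integrable_indic.
rewrite integral_sum//=.
- rewrite -sumEFin; apply: eq_bigr => k _.
  rewrite integralZl//; last exact: measurable_end_pos.
  rewrite integral_indic//; last exact: measurable_end_pos.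
  rewrite -mulrA EFinM; congr (_ * _)%E; exact: grid_count_law (leq_ord k).
- exact: measurable_end_pos.
- by move=> k; apply: integrableZl => //; exact: measurable_end_pos.
Qed.

Lemma measurable_grid_count_comp (g : R -> R) n :
  measurable_fun setT (fun w => g ((grid_count n w)%:R / n.+1%:R)).
Proof.
rewrite (_ : (fun w => _) = (fun k : nat => g (k%:R / n.+1%:R)) \o grid_count
  n)//.
apply: measurableT_comp => //.
move=> _ B _; rewrite setTI.
rewrite (_ : _ @^-1` B = \bigcup_(k in B) [set w | grid_count n w = k]).
  by apply: bigcup_measurable.
apply/seteqP; split=> [w Bw|w [k Bk wk]]; first by exists (grid_count n w).
by rewrite /preimage/= wk.
Qed.

(** The endpoint condition contributes the factor k / (n + 1) to the weights. It is absorbed into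
    the test function, which is why the Lipschitz bound concerns [g u * u]. *)
Lemma grid_count_cvg (g : R -> R) K : continuous g -> 0 <= K ->
  (forall u v, 0 <= u <= 1 -> 0 <= v <= 1 ->
    `|g u * u - g v * v| <= K * `|u - v|) ->
  (\int[P]_(w in end_pos) (g ((grid_count n w)%:R / n.+1%:R))%:E)%E @[n --> \oo]
    --> (2 / pi * quarter_int (fun y => g (sin y ^+ 2) * sin y ^+ 2))%:E.
Proof.
move=> cg K0 gK; under eq_fun do rewrite integral_grid_count.
apply: cvg_EFin; first exact: nearW.
apply: (arcsine_limit (h := fun u => g u * u) _ K0 gK) => u.
by apply: cvgM; [exact: cg|exact: cvg_id].
Qed.

End grid_count.

(** * Occupation times *)

(** Since [k] has countably many values, a preimage is a countable union of measurable
    rectangles. *)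
Lemma measurable_fun_nat_family d d' (T : measurableType d)
    (S : measurableType d') (R : realType) (f : nat -> T -> R) (k : S -> nat) :
  (forall n, measurable_fun setT (f n)) ->
  (forall n, measurable [set s | k s = n]) ->
  measurable_fun setT (fun p : T * S => f (k p.2) p.1).
Proof.
move=> mf mk _ B mB; rewrite setTI.
rewrite (_ : _ @^-1` B = \bigcup_n ((f n @^-1` B) `*` [set s | k s = n])).
  apply: bigcupT_measurable => n; apply: measurableX => //.
  exact: measurable_preimageT.
apply/seteqP; split=> [[w s] Bws|[w s] [n _ [/= Bn sn]]]; first by exists (k s).
by rewrite /preimage/= sn.
Qed.

Section occupation.
Context d (T : measurableType d) (R : realType) (P : probability T R).
Variable x : R -> {RV P >-> R}.
Hypothesis hx : standard_brownian_motion P x.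
Variables (t : R) (t_gt0 : 0 < t).
Notation mu := (@lebesgue_measure R).

Let h n := t / n.+1%:R.

Let h_gt0 n : 0 < h n. Proof. by rewrite divr_gt0. Qed.

(** The right end of the cell containing [s], because the count starts with the first partial sum
    and not with the value at time 0. A negative [s] falls in the cell of index 0, as [Num.truncn]
    is 0 there. *)
Let grid_time n (s : R) : R := (Num.truncn (s / h n)).+1%:R * h n.

Let grid_time_dist n s : `|grid_time n s - Num.max s 0| <= h n.
Proof.
have h0 := h_gt0 n; rewrite /grid_time; have [s0|s0] := leP 0 s.
  have /andP[] := truncn_itv (divr_ge0 s0 (ltW h0)).
  rewrite ler_pdivlMr// ltr_pdivrMr// -natr1 mulrDl mul1r => h1 h2.
  rewrite ger0_norm; last by rewrite subr_ge0 ltW.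
  by rewrite lerBlDl lerD2r.
have -> : Num.truncn (s / h n) = 0%N.
  by apply/truncn0Pn; rewrite -ltNge (lt_trans _ ltr01)// pmulr_llt0 ?invr_gt0.
by rewrite mul1r subr0 ger0_norm// ltW.
Qed.

Let h_cvg0 : h n @[n --> \oo] --> 0.
Proof.
rewrite -[X in _ --> X](mulr0 t); apply: cvgM; first exact: cvg_cst.
exact: cvg_harmonic.
Qed.

Let grid_time_cvg s : grid_time n s @[n --> \oo] --> Num.max s 0.
Proof.
apply/cvgrPdist_le => /= e e0.
have /cvgrPdist_le/(_ e e0) := h_cvg0; apply: filterS => n.
rewrite sub0r normrN (ger0_norm (ltW (h_gt0 n))) => hn.
by rewrite distrC (le_trans (grid_time_dist n s)).
Qed.

Let step_path n (p : T * R) : R := x (grid_time n p.2) p.1.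

(** Clamping the time at 0 avoids the unconstrained variables at negative times and gives a function
    on the whole product space. *)
Let path (p : T * R) : R := x (Num.max p.2 0) p.1.

Let pathE w s : 0 <= s -> path (w, s) = x s w.
Proof. by move=> s0; rewrite /path/= max_l. Qed.

Let step_path_cvg p : step_path n p @[n --> \oo] --> path p.
Proof.
case: p => w s; rewrite /step_path /path/=; set l := Num.max s 0.
have l0 : `[0, +oo[%classic l by rewrite /= in_itv/= andbT le_max lexx orbT.
have cw := @sbm_continuous_paths _ _ _ _ _ hx w.
(* Paths are continuous only relative to the half-line; this suffices because grid times are
   nonnegative. *)
move=> B hB; have nB : within `[0, +oo[ (nbhs l) ((fun s => x s w) @^-1` B).
  by rewrite nbhs_subspace_in//; exact: (cw l B hB).
suff : \forall n \near \oo, B (x (grid_time n s) w) by [].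
have : \forall n \near \oo, `[0, +oo[%classic (grid_time n s) ->
    B (x (grid_time n s) w) by exact: (@grid_time_cvg s _ nB).
apply: filterS => n; apply.
by rewrite /= in_itv/= andbT mulr_ge0// ltW.
Qed.

Let measurable_truncn n m : measurable [set s : R | Num.truncn (s / h n) = m].
Proof.
have h0 := h_gt0 n; case: m => [|m].
  (* All negative reals truncate to 0, so this cell is unbounded on the left. *)
  rewrite (_ : mkset _ = `]-oo, (h n)[%classic)//.
  apply/seteqP; split=> s /=; rewrite in_itv/=.
    by move/truncn0Pn; rewrite -ltNge ltr_pdivrMr// mul1r.
  by move=> sh; apply/truncn0Pn; rewrite -ltNge ltr_pdivrMr// mul1r.
rewrite (_ : mkset _ = `[(m.+1%:R * h n), (m.+2%:R * h n)[%classic)//.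
apply/seteqP; split=> s /=; rewrite in_itv/= -ler_pdivlMr// -ltr_pdivrMr//.
  move=> sm; have s0 : 0 <= s / h n.
    by rewrite ltW// (lt_le_trans ltr01)// -truncn_gt0 sm.
  by rewrite -sm truncn_itv.
exact: truncn_def.
Qed.

Let measurable_step_path n : measurable_fun setT (step_path n).
Proof.
have mx m : measurable_fun setT (x (m.+1%:R * h n) : T -> R) by [].
exact: (measurable_fun_nat_family mx (@measurable_truncn n)).
Qed.

(** Measurability at each fixed time does not give joint measurability; continuity does, by writing
    the path as a limit of step processes. *)
Let measurable_path_joint : measurable_fun setT path.
Proof.
by apply: (measurable_fun_cvg measurable_step_path) => p _; exact:
  step_path_cvg.
Qed.

Definition occupation (D B : set R) (w : T) : \bar R :=
  mu (D `&` [set s | B (x s w)]).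

Let sojourn (D B : set R) : set (T * R) := (setT `*` D) `&` path @^-1` B.

Let measurable_sojourn D B : measurable D -> measurable B ->
  measurable (sojourn D B).
Proof.
move=> mD mB; apply: measurableI; first exact: measurableX.
exact: measurable_preimageT.
Qed.

Let xsection_sojourn (D B : set R) w : D `<=` `[0, +oo[ ->
  xsection (sojourn D B) w = D `&` [set s | B (x s w)].
Proof.
move=> D0; have D0' s : D s -> 0 <= s by move/D0; rewrite /= in_itv/= andbT.
rewrite xsectionE; apply/seteqP; split=> s.
  move=> [[_ Ds] Bs]; split=> //; rewrite /mkset -pathE//; exact: D0'.
move=> [Ds Bs]; split=> //; rewrite /preimage/mkset pathE//; exact: D0'.
Qed.

Lemma measurable_sojourn_path (D B : set R) (w : T) : D `<=` `[0, +oo[ ->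
  measurable D ->
  measurable B -> measurable (D `&` [set s | B (x s w)]).
Proof.
move=> D0 mD mB; rewrite -xsection_sojourn//.
by apply: measurable_xsection; exact: measurable_sojourn.
Qed.

Lemma measurable_occupation (D B : set R) : D `<=` `[0, +oo[ -> measurable D ->
  measurable B -> measurable_fun setT (occupation D B).
Proof.
move=> D0 mD mB.
have := measurable_fun_xsection mu (measurable_sojourn mD mB).
by congr measurable_fun; apply/funext => w; rewrite /= xsection_sojourn.
Qed.

(** By Fubini the expected time at 0 is the integral over s of the probability that [x s] vanishes,
    which is 0 for s > 0. The interval is open at 0 because the path starts there. *)
Lemma occupation_eq0 : {ae P, forall w, occupation `]0, t[ [set 0] w = 0%E}.
Proof.
pose D : set R := `]0, t[%classic; pose Z : set R := [set 0].
rewrite -/D -/Z; have mD : measurable D by exact: measurable_itv.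
have mZ : measurable Z by exact: measurable_set1.
have D0 : D `<=` `[0, +oo[.
  by move=> s; rewrite /D /= !in_itv/= andbT => /andP[/ltW].
have mS := measurable_sojourn mD mZ.
have := indic_fubini_tonelli P mu mS.
rewrite indic_fubini_tonelli_FE// indic_fubini_tonelli_GE// => FG.
have : (\int[P]_w `|occupation D Z w| = 0)%E.
  transitivity (\int[P]_w (mu \o xsection (sojourn D Z)) w)%E.
    by apply: eq_integral => w _; rewrite /= xsection_sojourn// gee0_abs.
  rewrite FG; apply: integral0_eq => s _ /=.
  have [Ds|Ds] := pselect (D s); last first.
    rewrite (_ : ysection _ _ = set0) ?measure0//.
    by rewrite ysectionE; apply/seteqP; split=> // w [[_ /Ds]].
  have s0 : 0 < s by move: Ds; rewrite /D /= in_itv/= => /andP[].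
  rewrite (_ : ysection _ _ = [set w | x s w = 0]); first exact: (brownian_eq0
    hx).
  rewrite ysectionE; apply/seteqP; split=> w.
    by move=> [_ xs]; rewrite /mkset -pathE// ltW.
  by move=> xs; split=> //; rewrite /preimage/mkset pathE// ltW.
have mo := measurable_occupation D0 mD mZ.
move=> /(ae_eq_integral_abs P measurableT mo).
by apply: filterS => w; apply.
Qed.

(** Half-open cells tile the interval exactly, and on the cell of index i the step path has the
    constant value [psum] at [i.+1]; each positive sum therefore contributes one mesh length. *)
Let grid_count_measure n w :
  mu (`[0, t[ `&` [set s | 0 < step_path n (w, s)]) =
  ((grid_count x t n w)%:R * h n)%:E.
Proof.
have h0 := h_gt0 n.
pose I i := if 0 < x (i.+1%:R * h n) w
  then `[i%:R * h n, i.+1%:R * h n[%classic else set0.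
have mI i : measurable (I i) by rewrite /I; case: ifP.
have Itr m i s : (m = Num.truncn (s / h n)) -> 0 <= s ->
    `[i%:R * h n, i.+1%:R * h n[%classic s <-> i = m.
  move=> -> s0; rewrite /= in_itv/= -ler_pdivlMr// -ltr_pdivrMr//; split.
    by move/truncn_def.
  by move=> ->; apply: truncn_itv; rewrite divr_ge0// ltW.
have i0 i s : `[i%:R * h n, i.+1%:R * h n[%classic s -> 0 <= s.
  by rewrite /= in_itv/= => /andP[+ _]; apply: le_trans; rewrite mulr_ge0// ltW.
rewrite (_ : _ `&` _ = \big[setU/set0]_(i < n.+1) I i); last first.
  rewrite -(bigcup_mkord n.+1 I); apply/seteqP; split=> s.
    move=> [/=]; rewrite in_itv/= => /andP[s0 st] xs.
    exists (Num.truncn (s / h n)) => /=.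
      have : (Num.truncn (s / h n))%:R < n.+1%:R :> R.
        have /andP[+ _] := truncn_itv (divr_ge0 s0 (ltW h0)).
        move=> /le_lt_trans; apply.
        by rewrite ltr_pdivrMr// /h mulrC divfK.
      by rewrite ltr_nat.
    by rewrite /I xs; apply/(Itr _ _ _ erefl s0).
  move=> [i /= ilt]; rewrite /I; case: ifPn => // xi si.
  have s0 := i0 _ _ si; have iE := (Itr _ _ _ erefl s0).1 si.
  split; last by rewrite /= /step_path /grid_time/= -iE.
  rewrite /= in_itv/= s0/=; move: si; rewrite /= in_itv/= => /andP[_]
    /lt_le_trans; apply.
  have -> : t = n.+1%:R * h n by rewrite /h mulrC divfK.
  by rewrite ler_pM2r// ler_nat.
rewrite measure_semi_additive_ord_I//; last 2 first.
- apply/trivIsetP => i j _ _ /eqP ij; apply/seteqP; split=> // s [].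
  rewrite /I; case: ifPn => // _ si; case: ifPn => // _ sj; apply: ij.
  have s0 := i0 _ _ si.
  by rewrite ((Itr _ _ _ erefl s0).1 si) ((Itr _ _ _ erefl s0).1 sj).
- by apply: bigsetU_measurable => i _; exact: mI.
- rewrite /grid_count /pos_count natr_sum mulr_suml -sumEFin.
  apply: eq_bigr => i _; rewrite (psum_grid_step hx) /I -/(h n).
  case: ifPn => _; last by rewrite measure0 mul0r.
  rewrite /= lebesgue_measure_itv/= lte_fin ltr_pM2r// ltr_nat ltnSn.
  by rewrite -EFinB -mulrBl -natr1 [_ + 1]addrC addrK.
- by move=> i _; exact: mI.
Qed.

Let step_path_sign w s : path (w, s) != 0 ->
  \forall n \near \oo, (0 < step_path n (w, s)) = (0 < path (w, s)).
Proof.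
have cv := @step_path_cvg (w, s); rewrite neq_lt => /orP[p0|p0]; near=> n.
  have n0 : step_path n (w, s) < 0 by near: n; exact: cvgr_lt cv _ p0.
  by rewrite [RHS]ltNge [LHS]ltNge (ltW p0) (ltW n0).
have n0 : 0 < step_path n (w, s) by near: n; exact: cvgr_gt cv _ p0.
by rewrite n0 p0.
Unshelve. all: by end_near. Qed.

(** Dominated convergence of indicators over time: wherever the path is nonzero, the step path
    eventually has the same sign. *)
Lemma grid_count_occupation w : occupation `]0, t[ [set 0] w = 0%E ->
  ((grid_count x t n w)%:R * (t / n.+1%:R))%:E @[n --> \oo] -->
  occupation `[0, t[ [set u | 0 < u] w.
Proof.
move=> w0; rewrite (_ : (fun n => _) =
    fun n => mu (`[0, t[ `&` [set s | 0 < step_path n (w, s)])); last first.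
  by apply/funext => n; rewrite grid_count_measure.
pose D : set R := `[0, t[%classic.
have mD : measurable D by exact: measurable_itv.
have D0 s : D s -> 0 <= s by rewrite /D /= in_itv/= => /andP[].
pose An n : set R := [set s | 0 < step_path n (w, s)].
pose A : set R := [set s | 0 < path (w, s)].
have mP (f : T * R -> R) : measurable_fun setT f -> measurable [set s | 0 < f
  (w, s)].
  move=> mf; rewrite (_ : mkset _ = xsection (f @^-1` `]0, +oo[) w).
    by apply: measurable_xsection; apply: measurable_preimageT.
  by rewrite xsectionE; apply/seteqP; split=> s /=; rewrite in_itv/= andbT.
have mAn n : measurable (An n) by exact: mP.
have mA : measurable A by exact: mP.
have -> : occupation D [set u | 0 < u] w = (\int[mu]_(s in D) (\1_A s)%:E)%E.
  rewrite integral_indic//; congr (mu _).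
  apply/seteqP; split=> s.
    by move=> [Ds xs]; split=> //; rewrite /A /mkset pathE//; exact: D0.
  by move=> [As Ds]; split=> //; rewrite /mkset -pathE//; exact: D0.
rewrite (_ : (fun n => _) = fun n => (\int[mu]_(s in D) (\1_(An n) s)%:E)%E);
  last first.
  apply/funext => n; rewrite integral_indic//; last exact: mAn.
  by congr (mu _); apply/seteqP; split=> s [].
have mN : measurable (`]0, t[ `&` [set s | x s w = 0]).
  apply: (@measurable_sojourn_path _ [set 0] w) => //.
  by move=> s /=; rewrite !in_itv/= andbT => /andP[/ltW].
have [] // := @dominated_convergence _ _ _ mu D mD
  (fun n s => (\1_(An n) s)%:E) (fun s => (\1_A s)%:E) (cst 1%E).
- by move=> n; apply/measurable_EFinP/measurable_indic; exact: mAn.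
- by apply/measurable_EFinP/measurable_indic; exact: mA.
(* Convergence may fail only at zeros of the path; time 0 is added by hand since the assumption
   covers the open interval only. *)
- exists ([set 0] `|` (`]0, t[ `&` [set s | x s w = 0])); split.
  + exact: measurableU (measurable_set1 _) mN.
  + rewrite null_set_setU//; exact: lebesgue_measure_set1.
  + move=> s /= /not_implyP[Ds nc]; have [->|s0] := eqVneq s 0; first by left.
    right; split.
      move: Ds; rewrite /D /= !in_itv/= => /andP[s0' ->]; rewrite andbT.
      by rewrite lt_neqAle eq_sym s0.
    apply/eqP/negPn/negP => xs; apply: nc; apply: cvg_near_cst.
    have := step_path_sign (w := w) (s := s); rewrite pathE ?D0// => /(_ xs).
    apply: filterS => n An_A; congr (_ %:E); rewrite !indicE; congr
      (nat_of_bool _)%:R.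
    by apply/idP/idP; rewrite !inE /An /A /mkset pathE ?D0// An_A.
- apply: measurable_bounded_integrable => //.
    by rewrite /D /= lebesgue_measure_itv/= lte_fin t_gt0 ltry.
  by exists 1; split=> // r r1 s _; rewrite normr1 ltW.
- by apply/aeW => s n _; rewrite gee0_abs ?lee_fin// indicE; case: (_ \in _).
Qed.

End occupation.

(** * Lipschitz approximations of the indicator of a half-line *)

Section ramp.
Context {R : realType}.
Variables (s c : R) (s_le1 : `|s| <= 1).

(** The factor [s] selects the event: 1 for values at most [c], -1 for values at least [c], and 0
    for the sure event, which serves to compute the probability of the condition. *)
Definition ramp (m : nat) (y : R) : R :=
  Num.max 0 (1 - m%:R * Num.max 0 (s * (y - c))).

Lemma ramp_itv m y : 0 <= ramp m y <= 1.
Proof.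
rewrite /ramp le_max lexx/= ge_max ler01/= gerBl.
by rewrite mulr_ge0// le_max lexx.
Qed.

Lemma ramp_lipschitz m u v : `|ramp m u - ramp m v| <= m%:R * `|u - v|.
Proof.
have max_lip (p q : R) : `|Num.max 0 p - Num.max 0 q| <= `|p - q|.
  have := ler_norm (p - q); have := ler_norm (q - p); rewrite (distrC q p).
  have : 0 <= `|p - q| by [].
  by rewrite ler_norml; case: (leP 0 p) => p0; case: (leP 0 q) => q0; lra.
apply: (le_trans (max_lip _ _)).
set p := Num.max 0 (s * (u - c)); set q := Num.max 0 (s * (v - c)).
rewrite (_ : _ - _ = m%:R * (q - p)); last by ring.
rewrite normrM ger0_norm// ler_wpM2l// distrC (le_trans (max_lip _ _))//.
rewrite (_ : _ - _ = s * (u - v)); last by ring.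
by rewrite normrM ler_piMl.
Qed.

Lemma continuous_ramp m : continuous (ramp m).
Proof.
move=> y; apply/cvgrPdist_le => /= e e0.
have d0 : 0 < e / (m%:R + 1) by rewrite divr_gt0// ltr_wpDl.
near=> z; apply: (le_trans (ramp_lipschitz m y z)).
have : `|y - z| <= e / (m%:R + 1).
  by near: z; exists (e / (m%:R + 1)) => //= z /ltW.
rewrite ler_pdivlMr ?ltr_wpDl//; apply: le_trans.
by rewrite mulrC ler_wpM2l// lerDl.
Unshelve. all: by end_near. Qed.

Lemma ramp_mul_lipschitz m u v : 0 <= u <= 1 -> 0 <= v <= 1 ->
  `|ramp m u * u - ramp m v * v| <= (m%:R + 1) * `|u - v|.
Proof.
move=> /andP[u0 u1] _.
have -> : ramp m u * u - ramp m v * v =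
  (ramp m u - ramp m v) * u + ramp m v * (u - v) by ring.
rewrite (le_trans (ler_normD _ _))// !normrM mulrDl mul1r lerD//.
  by rewrite -[leRHS]mulr1 ler_pM ?ramp_lipschitz// ger0_norm.
have /andP[r0 r1] := ramp_itv m v.
by rewrite ler_piMl// ger0_norm.
Qed.

(** The sequence is eventually constant at every point, including [y = c], where it equals 1; hence
    the limit law needs no continuity argument at [c]. *)
Lemma ramp_cvg y : ramp m y @[m --> \oo] --> ((s * (y - c) <= 0)%R%:R : R).
Proof.
have [sy|sy] := leP (s * (y - c)) 0.
  apply: cvg_near_cst; apply: nearW => m.
  by rewrite /ramp [Num.max 0 (s * _)]max_l// mulr0 subr0 max_r.
apply: cvg_near_cst; near=> m; rewrite /ramp [Num.max 0 (s * _)]max_r ?(ltW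
  sy)//.
rewrite max_l// subr_le0 -ler_pdivrMr//.
by near: m; exact: nbhs_infty_ger.
Unshelve. all: by end_near. Qed.

(** Used on both sides of the same identity: for the probability with [psi] equal to 1, and for
    Lebesgue measure on the angles with [psi] equal to the squared sine. *)
Lemma integral_ramp_cvg d (T : measurableType d) (mu : {measure set T -> \bar
  R})
    (D : set T) (phi psi : T -> R) : measurable D -> (mu D < +oo)%E ->
  measurable_fun D phi -> measurable_fun D psi ->
  (forall w, D w -> `|psi w| <= 1) ->
  (\int[mu]_(w in D) (ramp m (phi w) * psi w)%:E)%E @[m --> \oo] -->
  (\int[mu]_(w in D) ((s * (phi w - c) <= 0)%R%:R * psi w)%:E)%E.
Proof.
move=> mD Doo mphi mpsi psi1.
have mr m : measurable_fun D (fun w => (ramp m (phi w) * psi w)%:E).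
  apply/measurable_EFinP; apply: measurable_funM => //.
  apply: (measurable_comp measurableT) => //.
  by apply: continuous_measurable_fun; exact: continuous_ramp.
have cr w : (ramp m (phi w) * psi w)%:E @[m --> \oo] -->
    ((s * (phi w - c) <= 0)%R%:R * psi w)%:E.
  apply: cvg_EFin; first exact: nearW.
  by apply: cvgM; [exact: ramp_cvg|exact: cvg_cst].
have [] // := @dominated_convergence _ _ _ mu D mD
  (fun m w => (ramp m (phi w) * psi w)%:E)
  (fun w => ((s * (phi w - c) <= 0)%R%:R * psi w)%:E) (cst 1%E) mr.
- by apply: (emeasurable_fun_cvg _ _ mr) => w _; exact: cr.
- by apply/aeW => w _; exact: cr.
- apply: measurable_bounded_integrable => //.
  by exists 1; split=> // r r1 w _; rewrite normr1 ltW.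
- apply/aeW => w m Dw; rewrite /= lee_fin normrM.
  have /andP[r0 r1] := ramp_itv m (phi w).
  by rewrite mulr_ile1// ?psi1// ger0_norm.
Qed.

End ramp.

(** * The law of the positive fraction on the event of a positive end point *)

Section occupation_law.
Context d (T : measurableType d) (R : realType) (P : probability T R).
Variable x : R -> {RV P >-> R}.
Hypothesis hx : standard_brownian_motion P x.
Variables (t : R) (t_gt0 : 0 < t).

Definition pos_fraction (w : T) : R :=
  fine (occupation x `[0, t[ [set u | 0 < u] w) / t.

Let D0 : (`[0, t[%classic : set R) `<=` `[0, +oo[.
Proof. by move=> u /=; rewrite !in_itv/= andbT => /andP[]. Qed.

Lemma occupation_le (B : set R) w : measurable B ->
  (occupation x `[0%R, t[ B w <= t%:E)%E.
Proof.
move=> mB; rewrite /occupation.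
have -> : t%:E = lebesgue_measure (`[0%R, t[%classic : set R).
  by rewrite lebesgue_measure_itv/= lte_fin t_gt0 oppr0 adde0.
have mS := measurable_sojourn_path hx t_gt0 w D0 (measurable_itv _) mB.
by apply: le_measure; rewrite ?inE//; exact: mS.
Qed.

Let pos_meas : measurable ([set u | 0 < u] : set R).
Proof.
rewrite (_ : mkset _ = `]0, +oo[%classic)//.
by apply/seteqP; split=> u /=; rewrite in_itv/= andbT.
Qed.

Lemma measurable_pos_fraction : measurable_fun setT pos_fraction.
Proof.
apply: measurable_funM => //; apply: measurableT_comp => //.
exact: (measurable_occupation hx t_gt0).
Qed.

Lemma grid_count_pos_fraction :
  {ae P, forall w, (grid_count x t n w)%:R / n.+1%:R @[n --> \oo] -->
    pos_fraction w}.
Proof.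
have := occupation_eq0 hx t_gt0; apply: filterS => w w0.
have fo : occupation x `[0, t[ [set u | 0 < u] w \is a fin_num.
  by rewrite ge0_fin_numE// (le_lt_trans (occupation_le _ pos_meas))// ltry.
have := grid_count_occupation hx t_gt0 w0; rewrite -(fineK fo) => /fine_cvg cv.
rewrite /pos_fraction; rewrite (_ : (fun n => _) = (fun n =>
  fine ((grid_count x t n w)%:R * (t / n.+1%:R))%:E / t)); last first.
  by apply/funext => n /=; rewrite mulrCA mulrAC divff ?mul1r// gt_eqF.
by apply: cvgM; [exact: cv|exact: cvg_cst].
Qed.

(** Both sides are limits of the same discrete expectations, one by bounded convergence and the
    other by [grid_count_cvg]. *)
Lemma integral_pos_fraction (g : R -> R) K : continuous g -> 0 <= K ->
  (forall y, `|g y| <= 1) ->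
  (forall u v, 0 <= u <= 1 -> 0 <= v <= 1 ->
    `|g u * u - g v * v| <= K * `|u - v|) ->
  (\int[P]_(w in end_pos x t) (g (pos_fraction w))%:E =
    (2 / pi * quarter_int (fun y => g (sin y ^+ 2) * sin y ^+ 2))%:E)%E.
Proof.
move=> cg K0 g1 gK.
have mE := measurable_end_pos x t.
apply: cvg_unique (grid_count_cvg hx t_gt0 cg K0 gK) => //.
have [] // := @dominated_convergence _ _ _ P (end_pos x t) mE
  (fun n w => (g ((grid_count x t n w)%:R / n.+1%:R))%:E)
  (fun w => (g (pos_fraction w))%:E) (cst 1%E).
- by move=> n; apply/measurable_EFinP/measurable_funTS; exact:
  measurable_grid_count_comp.
- apply/measurable_EFinP/measurable_funTS; apply: measurableT_comp.
    exact: continuous_measurable_fun.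
  exact: measurable_pos_fraction.
- have := grid_count_pos_fraction; apply: filterS => w cw _.
  apply: cvg_EFin; first exact: nearW.
  by apply: (cvg_comp _ g); [exact: cw|exact: cg].
- exact: finite_measure_integrable_cst.
- by apply/aeW => w n _; rewrite /= lee_fin.
Qed.

(** The region [D] is a parameter tied by an equation, so that each use can present it as an
    explicit interval of angles. *)
Lemma pos_fraction_law (s c : R) (D : set R) : `|s| <= 1 ->
  D = [set y | (0 <= y <= pi / 2) && (s * (sin y ^+ 2 - c) <= 0)] ->
  P ([set w | s * (pos_fraction w - c) <= 0] `&` end_pos x t) =
  ((2 / pi)%:E * \int[lebesgue_measure]_(y in D) (sin y ^+ 2)%:E)%E.
Proof.
move=> s1 DE; have mE := measurable_end_pos x t.
have mphi := measurable_pos_fraction.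
have Eoo : (P (end_pos x t) < +oo)%E.
  by rewrite (le_lt_trans (probability_le1 _ mE))// ltry.
pose I : set R := `[0, pi / 2]%classic.
have mI : measurable I by exact: measurable_itv.
have Ioo : (lebesgue_measure I < +oo)%E.
  rewrite /I lebesgue_measure_itv/= lte_fin divr_gt0 ?pi_gt0//.
  by rewrite oppr0 adde0 ltry.
have csin2 : continuous (fun y : R => sin y ^+ 2).
  move=> y; apply: (cvg_comp _ (fun z : R => z ^+ 2)); first exact:
    continuous_sin.
  exact: exprn_continuous.
have msin2 : measurable_fun I (fun y : R => sin y ^+ 2).
  by apply: measurable_funTS; exact: continuous_measurable_fun.
have sin2_le1 (y : R) : `|sin y ^+ 2| <= 1.
  by rewrite ger0_norm ?sqr_ge0// sin2cos2 gerBl sqr_ge0.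
have c1 := @integral_ramp_cvg R s c s1 _ _ P _ pos_fraction (cst 1) mE Eoo
  (measurable_funTS mphi) (measurable_cst _).
have c2 := @integral_ramp_cvg R s c s1 _ _ (@lebesgue_measure R) _ _ _ mI Ioo
  msin2 msin2 (fun y _ => sin2_le1 y).
have eqm m : (\int[P]_(w in end_pos x t) (ramp s c m (pos_fraction w) * 1)%:E =
  (2 / pi)%:E * \int[lebesgue_measure]_(y in I)
     (ramp s c m (sin y ^+ 2) * sin y ^+ 2)%:E)%E.
  under eq_integral do rewrite mulr1.
  rewrite (integral_pos_fraction (K := m%:R + 1)) ?addr_ge0//.
  - rewrite EFinM; congr (_ * _)%E; rewrite /quarter_int /Rintegral fineK//.
    apply: integrable_fin_num => //; apply: integrable_quarter => y.
    apply: cvgM; last exact: csin2.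
    by apply: (cvg_comp _ (ramp s c m)); [exact: csin2|exact: continuous_ramp].
  - exact: continuous_ramp.
  - by move=> y; have /andP[r0 r1] := ramp_itv s c m y; rewrite ger0_norm.
  - exact: ramp_mul_lipschitz.
have c1' : forall w, end_pos x t w -> `|(cst 1 : T -> R) w| <= 1.
  by move=> w _; rewrite /cst normr1.
have := c1 c1'; rewrite /cst; under eq_fun do rewrite eqm.
have fin2 : (2 / pi : R)%:E \is a fin_num by [].
move=> {c1 c1'} c1; have {}c2 := cvgeZl fin2 c2.
have EQ := @cvg_unique _ (@ereal_hausdorff R) _ _ _ _ c1 c2.
set A := [set w | _].
have mA : measurable A.
  apply: measurable_set_ler; last exact: measurable_cst.
  by apply: measurable_funM => //; exact: measurable_funB.
transitivity (\int[P]_(w in end_pos x t) (\1_A w)%:E)%E.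
  by rewrite integral_indic.
transitivity (\int[P]_(w in end_pos x t)
    ((s * (pos_fraction w - c) <= 0)%R%:R * 1)%:E)%E.
  apply: eq_integral => w _; rewrite mulr1 indicE; congr (nat_of_bool _)%:R%:E.
  by apply/idP/idP; rewrite inE.
rewrite EQ; congr (_ * _)%E.
have -> : D = I `&` [set y | s * (sin y ^+ 2 - c) <= 0].
  rewrite DE /I; apply/seteqP; split=> y.
    by move=> /andP[y1 y2]; split=> //; rewrite /= in_itv.
  by move=> [y1 y2]; apply/andP; split=> //; move: y1; rewrite /= in_itv.
rewrite integral_mkcondr; apply: eq_integral => y _; rewrite patchE.
case: ifPn => [|/negP]; rewrite inE/=; first by move=> ->; rewrite mul1r.
by move=> /negP/negbTE ->; rewrite mul0r.
Qed.

End occupation_law.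

(** * Evaluation of the arcsine integrals *)

Section exhaustion.
Context {R : realType}.
Notation mu := (@lebesgue_measure R).
Variables (f : R -> R) (u : nat -> R) (l : R).
Hypothesis ul : u n @[n --> \oo] --> l.

(** Substitution is available only for integrands continuous up to the boundary, which fails at [l].
    Monotone convergence fills the gap, and the value at the single point [l] is irrelevant. *)
Lemma integral_itv_cvg_left a : nondecreasing_seq u -> (forall n, u n < l) ->
  {in `[a, l[, continuous f} -> (forall y, 0 <= f y) ->
  (\int[mu]_(y in `[a, u n]) (f y)%:E)%E @[n --> \oo] -->
  (\int[mu]_(y in `[a, l]) (f y)%:E)%E.
Proof.
move=> ndu ult cf f0.
have cfw : {within `[a, l[, continuous f}.
  by apply: continuous_in_subspaceT => y; rewrite inE; exact: cf.
have mf : measurable_fun `[a, l[ (EFin \o f).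
  by apply/measurable_EFinP; apply: subspace_continuous_measurable_fun cfw.
have su n : `[a, u n] `<=` `[a, l[.
  by move=> y /=; rewrite !in_itv/= => /andP[-> /le_lt_trans]; exact.
rewrite -integral_itv_bndo_bndc//.
have -> : `[a, l[%classic = \bigcup_n `[a, u n]%classic.
  apply/seteqP; split=> [y|y [n _]]; last exact: su.
  rewrite /= in_itv/= => /andP[ay yl].
  have [n _ /(_ n (leqnn n)) yu] := cvgr_gt _ ul _ yl.
  by exists n => //=; rewrite in_itv/= ay ltW.
apply: ge0_nondecreasing_set_cvg_integral.
- move=> m n mn; apply/subsetPset => y /=; rewrite !in_itv/= => /andP[-> yu].
  by rewrite (le_trans yu)// ndu.
- by move=> n; exact: measurable_itv.
- move=> n; apply: measurable_funS mf; [exact: measurable_itv|exact: su].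
- by move=> n y _; rewrite lee_fin.
Qed.

Lemma integral_itv_cvg_right b : nonincreasing_seq u -> (forall n, l < u n) ->
  {in `]l, b], continuous f} -> (forall y, 0 <= f y) ->
  (\int[mu]_(y in `[u n, b]) (f y)%:E)%E @[n --> \oo] -->
  (\int[mu]_(y in `[l, b]) (f y)%:E)%E.
Proof.
move=> niu ult cf f0.
have cfw : {within `]l, b], continuous f}.
  by apply: continuous_in_subspaceT => y; rewrite inE; exact: cf.
have mf : measurable_fun `]l, b] (EFin \o f).
  by apply/measurable_EFinP; apply: subspace_continuous_measurable_fun cfw.
have su n : `[u n, b] `<=` `]l, b].
  by move=> y /=; rewrite !in_itv/= => /andP[uy ->]; rewrite (lt_le_trans _ uy).
rewrite -integral_itv_obnd_cbnd//.
have -> : `]l, b]%classic = \bigcup_n `[u n, b]%classic.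
  apply/seteqP; split=> [y|y [n _]]; last exact: su.
  rewrite /= in_itv/= => /andP[ly yb].
  have [n _ /(_ n (leqnn n)) yu] := cvgr_lt _ ul _ ly.
  by exists n => //=; rewrite in_itv/= yb andbT ltW.
apply: ge0_nondecreasing_set_cvg_integral.
- move=> m n mn; apply/subsetPset => y /=; rewrite !in_itv/= => /andP[yu ->].
  by rewrite andbT (le_trans _ yu)// niu.
- by move=> n; exact: measurable_itv.
- move=> n; apply: measurable_funS mf; [exact: measurable_itv|exact: su].
- by move=> n y _; rewrite lee_fin.
Qed.

End exhaustion.

Section arcsine_integrals.
Context {R : realType}.
Notation mu := (@lebesgue_measure R).
Implicit Types y phi : R.

Let pi2_gt0 : (0 : R) < pi / 2. Proof. by rewrite divr_gt0// pi_gt0. Qed.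

Let in_pi (y : R) : 0 <= y <= pi / 2 -> y \in `[0, pi].
Proof.
move=> /andP[y0 y1]; rewrite in_itv/= y0 (le_trans y1)//.
by rewrite ler_pdivrMr// ler_pMr ?pi_gt0// ler1n.
Qed.

Lemma cos_homo_quarter (y z : R) : 0 <= y -> z <= pi / 2 -> y < z -> cos z <
  cos y.
Proof.
move=> y0 z1 yz; have yI : y \in `[0, pi] by rewrite in_pi// y0 (le_trans (ltW
  yz)).
have zI : z \in `[0, pi] by rewrite in_pi// (le_trans y0 (ltW yz)).
by rewrite ltr_cos.
Qed.

Let cos_ge0 (y : R) : 0 <= y <= pi / 2 -> 0 <= cos y.
Proof.
by move=> /andP[y0 y1]; rewrite cos_ge0_pihalf// y1 (le_trans _ y0)// oppr_le0
  ltW.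
Qed.

Let sin_ge0 (y : R) : 0 <= y <= pi / 2 -> 0 <= sin y.
Proof. by move=> y01; apply: sin_ge0_pi; have := in_pi y01; rewrite in_itv. Qed.

Let cos2_lt (y z : R) : 0 <= y -> z <= pi / 2 -> y < z -> cos z ^+ 2 < cos y ^+
  2.
Proof.
move=> y0 z1 yz; have cz : 0 <= cos z by rewrite cos_ge0// (le_trans y0 (ltW
  yz)).
have cy : 0 <= cos y by rewrite cos_ge0// y0 (le_trans (ltW yz)).
by rewrite ltrXn2r// cos_homo_quarter.
Qed.

Lemma sin2_lt (y z : R) : 0 <= y -> z <= pi / 2 -> y < z -> sin y ^+ 2 < sin z
  ^+ 2.
Proof. by move=> y0 z1 yz; rewrite !sin2cos2 ltrD2l ltrN2 cos2_lt. Qed.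

Let is_derive_sin2 y : is_derive y (1 : R) (fun z : R => sin z ^+ 2) (2 * sin y
  * cos y).
Proof.
rewrite (_ : (fun z => _) = (@sin R) ^+ 2); last by apply/funext => z; rewrite
  fctE.
by apply: is_derive_eq; rewrite /GRing.scale/= expr1.
Qed.

Let is_derive_cos2 y : is_derive y (1 : R) (fun z : R => cos z ^+ 2) (- (2 *
  sin y * cos y)).
Proof.
rewrite (_ : (fun z => _) = (@cos R) ^+ 2); last by apply/funext => z; rewrite
  fctE.
by apply: is_derive_eq; rewrite /GRing.scale/= expr1 mulrN; congr (- _); ring.
Qed.

Let derive_sin2 : (fun z : R => sin z ^+ 2)^`()%classic = fun y => 2 * sin y *
  cos y.
Proof. by apply/funext => y; rewrite derive1E; apply: derive_val. Qed.

Let derive_cos2 : (fun z : R => cos z ^+ 2)^`()%classic = fun y => - (2 * sin y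
  * cos y).
Proof. by apply/funext => y; rewrite derive1E; apply: derive_val. Qed.

Let continuous_sincos : continuous (fun y : R => 2 * sin y * cos y).
Proof.
move=> y; apply: cvgM; last exact: continuous_cos.
by apply: cvgM; [exact: cvg_cst|exact: continuous_sin].
Qed.

Let derivable_continuous (F dF : R -> R) :
  (forall y, is_derive y (1 : R) F (dF y)) -> continuous F.
Proof.
by move=> h y; apply/differentiable_continuous/derivable1_diffP; case: (h y).
Qed.

Let derivable_oo (F dF : R -> R) a b :
  (forall y, is_derive y (1 : R) F (dF y)) -> derivable_oo_LRcontinuous F a b.
Proof.
move=> h; have cF := derivable_continuous h; split.
- by move=> y _; case: (h y).
- by apply: cvg_at_right_filter; exact: cF.
- by apply: cvg_at_left_filter; exact: cF.
Qed.

Let continuous_odds y : y < 1 -> {for y, continuous (fun z : R => Num.sqrt (z /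
  (1 - z)))}.
Proof.
move=> y1; apply: (cvg_comp _ Num.sqrt); last exact: sqrt_continuous.
apply: cvgM; first exact: cvg_id.
apply: cvgV; first by rewrite gt_eqF// subr_gt0.
by apply: cvgB; [exact: cvg_cst|exact: cvg_id].
Qed.

Let continuous_odds' y : 0 < y -> {for y, continuous (fun z : R => Num.sqrt ((1
  - z) / z))}.
Proof.
move=> y1; apply: (cvg_comp _ Num.sqrt); last exact: sqrt_continuous.
apply: cvgM; first by apply: cvgB; [exact: cvg_cst|exact: cvg_id].
by apply: cvgV; [rewrite gt_eqF|exact: cvg_id].
Qed.

(** For [u] the sine and [v] the cosine of an angle this is the integrand after substitution, times
    the Jacobian. *)
Let sqrt_ratio (u v : R) : 0 <= u -> 0 < v ->
  Num.sqrt (u ^+ 2 / v ^+ 2) * (2 * u * v) = 2 * u ^+ 2.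
Proof.
move=> u0 v0; rewrite -expr_div_n sqrtr_sqr ger0_norm ?divr_ge0//; last exact:
  ltW.
by field; rewrite gt_eqF.
Qed.

Let integral_odds_lt phi : 0 <= phi < pi / 2 ->
  (\int[mu]_(y in `[0%R, (sin phi ^+ 2)%R]) (Num.sqrt (y / (1 - y)))%:E =
   \int[mu]_(y in `[0%R, phi]) (2 * sin y ^+ 2)%:E)%E.
Proof.
move=> /andP[p0 p1]; have F0 : sin 0 ^+ 2 = 0 :> R by rewrite sin0 expr0n.
rewrite -{1}F0 (@integration_by_substitution_increasing _
  (fun z => sin z ^+ 2) (fun z => Num.sqrt (z / (1 - z))) 0 phi)//.
- apply: eq_integral => y; rewrite inE/= in_itv/= => /andP[y0 y1].
  rewrite fctE derive_sin2/= -cos2sin2; congr _%:E; apply: sqrt_ratio.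
    by apply: sin_ge0; rewrite y0 ltW// (le_lt_trans y1).
  apply: cos_gt0_pihalf; rewrite (le_lt_trans y1 p1) andbT.
  by rewrite (lt_le_trans _ y0)// oppr_lt0.
- move=> y z; rewrite !in_itv/= => /andP[y0 _] /andP[_ z1].
  by apply: sin2_lt => //; rewrite (le_trans z1)// ltW.
- by rewrite derive_sin2 => y _; exact: continuous_sincos.
- rewrite derive_sin2; apply/cvg_ex; exists (2 * sin 0 * cos 0).
  by apply: cvg_at_right_filter; exact: continuous_sincos.
- rewrite derive_sin2; apply/cvg_ex; exists (2 * sin phi * cos phi).
  by apply: cvg_at_left_filter; exact: continuous_sincos.
- exact: derivable_oo is_derive_sin2.
- apply: continuous_in_subspaceT => y; rewrite inE/= in_itv/= => /andP[_ y1].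
  apply: continuous_odds; rewrite (le_lt_trans y1)//.
  have := sin2_lt p0 (lexx _) p1; by rewrite sin_pihalf expr1n.
Qed.

(** Substituting the squared cosine exchanges y and 1 - y, so the dual integrand also becomes twice
    the squared sine, now on an interval of large angles. *)
Let integral_odds'_lt phi psi : 0 <= phi -> phi <= psi -> psi < pi / 2 ->
  (\int[mu]_(y in `[(cos psi ^+ 2)%R, (cos phi ^+ 2)%R]) (Num.sqrt ((1 - y) /
    y))%:E =
   \int[mu]_(y in `[phi, psi]) (2 * sin y ^+ 2)%:E)%E.
Proof.
move=> p0 pp p1.
rewrite (@integration_by_substitution_decreasing _
  (fun z => cos z ^+ 2) (fun z => Num.sqrt ((1 - z) / z)) phi psi)//.
- apply: eq_integral => y; rewrite inE/= in_itv/= => /andP[y0 y1].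
  rewrite !fctE derive_cos2/= opprK -sin2cos2; congr _%:E; apply: sqrt_ratio.
    by apply: sin_ge0; rewrite (le_trans p0 y0) ltW// (le_lt_trans y1).
  apply: cos_gt0_pihalf; rewrite (le_lt_trans y1 p1) andbT.
  by rewrite (lt_le_trans _ y0)// (lt_le_trans _ p0)// oppr_lt0.
- move=> y z; rewrite !in_itv/= => /andP[y0 y1] /andP[z0 _] zy.
  by apply: cos2_lt => //; [exact: le_trans z0|rewrite (le_trans y1)// ltW].
- by rewrite derive_cos2 => y _; apply: cvgN; exact: continuous_sincos.
- rewrite derive_cos2; apply/cvg_ex; exists (- (2 * sin phi * cos phi)).
  by apply: cvg_at_right_filter; apply: cvgN; exact: continuous_sincos.
- rewrite derive_cos2; apply/cvg_ex; exists (- (2 * sin psi * cos psi)).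
  by apply: cvg_at_left_filter; apply: cvgN; exact: continuous_sincos.
- exact: derivable_oo is_derive_cos2.
- apply: continuous_in_subspaceT => y; rewrite inE/= in_itv/= => /andP[y1 _].
  apply: continuous_odds'; rewrite (lt_le_trans _ y1)// exprn_gt0//.
  apply: cos_gt0_pihalf; rewrite p1 andbT (lt_le_trans _ pp)//.
  by rewrite (lt_le_trans _ p0)// oppr_lt0.
Qed.

Let csin2 : continuous (fun y : R => sin y ^+ 2) := derivable_continuous
  is_derive_sin2.
Let ccos2 : continuous (fun y : R => cos y ^+ 2) := derivable_continuous
  is_derive_cos2.

Let c2sin2 : continuous (fun y : R => 2 * sin y ^+ 2).
Proof. by move=> y; apply: cvgM; [exact: cvg_cst|exact: csin2]. Qed.

Let approach (a b : R) (n : nat) := b - (b - a) / n.+1%:R.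

Let approach_lt a b n : a < b -> approach a b n < b.
Proof. by move=> ab; rewrite /approach gtrBl divr_gt0// subr_gt0. Qed.

Let approach_ge a b n : a < b -> a <= approach a b n.
Proof.
move=> ab; rewrite /approach lerBrDl -lerBrDr ler_pdivrMr// ler_pMr ?subr_gt0//.
by rewrite ler1n.
Qed.

Let approach_nd a b : a < b -> nondecreasing_seq (approach a b).
Proof.
move=> ab m n mn; rewrite /approach lerD2l lerN2 ler_pM2l ?subr_gt0//.
by rewrite lef_pV2 ?posrE// ler_nat.
Qed.

Let approach_cvg a b : approach a b n @[n --> \oo] --> b.
Proof.
rewrite -[X in _ --> X]subr0 -[X in _ - X](mulr0 (b - a)).
apply: cvgB; first exact: cvg_cst.
by apply: cvgM; [exact: cvg_cst|exact: cvg_harmonic].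
Qed.

Lemma integral_odds phi : 0 <= phi <= pi / 2 ->
  (\int[mu]_(y in `[0%R, (sin phi ^+ 2)%R]) (Num.sqrt (y / (1 - y)))%:E =
   \int[mu]_(y in `[0%R, phi]) (2 * sin y ^+ 2)%:E)%E.
Proof.
move=> /andP[]; rewrite le_eqVlt => /predU1P[<- _|p0 p1].
  by rewrite sin0 expr0n !set_itv1 !integral_set1.
have ap := approach_lt _ p0; pose u := approach 0 phi.
have u0 n : 0 <= u n by exact: approach_ge.
apply: (@cvg_unique _ (@ereal_hausdorff R) _ _ _ _
  (integral_itv_cvg_left (u := fun n => sin (u n) ^+ 2) (a := 0) _ _ _ _ _)).
- by apply: (cvg_comp _ (fun y : R => sin y ^+ 2)); [exact: approach_cvg|exact:
  csin2].
- move=> m n mn; have := approach_nd p0 mn; rewrite le_eqVlt => /predU1P[e|lt].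
    by rewrite /u e.
  by rewrite ltW// sin2_lt// (le_trans (ltW (ap n))).
- by move=> n; rewrite sin2_lt.
- move=> y; rewrite in_itv/= => /andP[_ y1]; apply: continuous_odds.
  by rewrite (lt_le_trans y1)// sin2cos2 gerBl sqr_ge0.
- by move=> y; exact: sqrtr_ge0.
rewrite (_ : (fun n => _) = fun n => (\int[mu]_(y in `[0%R, u n]) (2 * sin y ^+
  2)%:E)%E).
  apply: integral_itv_cvg_left => //.
  - exact: approach_cvg.
  - exact: approach_nd.
  - by move=> y; rewrite mulr_ge0 ?sqr_ge0.
apply/funext => n; rewrite integral_odds_lt// u0 (lt_le_trans (ap n))//.
Qed.

(** The singularity at y = 0 corresponds to the angle [pi / 2], which is approached from below. *)
Lemma integral_odds' phi : 0 <= phi <= pi / 2 ->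
  (\int[mu]_(y in `[0%R, (cos phi ^+ 2)%R]) (Num.sqrt ((1 - y) / y))%:E =
   \int[mu]_(y in `[phi, (pi / 2)%R]) (2 * sin y ^+ 2)%:E)%E.
Proof.
move=> /andP[p0]; rewrite le_eqVlt => /predU1P[->|p1].
  by rewrite cos_pihalf expr0n !set_itv1 !integral_set1.
have ap := approach_lt _ p1; pose u := approach phi (pi / 2).
have u0 n : phi <= u n by exact: approach_ge.
have u0' n : 0 <= u n by exact: le_trans (u0 n).
have cu : cos (u n) ^+ 2 @[n --> \oo] --> (0 : R).
  have <- : cos (pi / 2) ^+ 2 = 0 :> R by rewrite cos_pihalf expr0n.
  by apply: (cvg_comp _ (fun y : R => cos y ^+ 2)); [exact: approach_cvg|exact:
    ccos2].
apply: (@cvg_unique _ (@ereal_hausdorff R) _ _ _ _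
  (integral_itv_cvg_right cu (b := cos phi ^+ 2) _ _ _ _)).
- move=> m n mn; have := approach_nd p1 mn; rewrite le_eqVlt => /predU1P[e|lt].
    by rewrite /u e.
  by rewrite ltW// cos2_lt// ltW.
- by move=> n; have := cos2_lt (u0' n) (lexx _) (ap n); rewrite cos_pihalf
  expr0n.
- by move=> y; rewrite in_itv/= => /andP[y1 _]; exact: continuous_odds'.
- by move=> y; exact: sqrtr_ge0.
rewrite (_ : (fun n => _) = fun n => (\int[mu]_(y in `[phi, u n]) (2 * sin y ^+
  2)%:E)%E).
  apply: integral_itv_cvg_left => //.
  - exact: approach_cvg.
  - exact: approach_nd.
  - by move=> y; rewrite mulr_ge0 ?sqr_ge0.
by apply/funext => n; rewrite integral_odds'_lt.
Qed.

End arcsine_integrals.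

(** * The conditional laws *)

(** As division by 0 returns 0, both sides vanish when [u] or [v] is 0; the two forms of the
    integrand therefore agree at the end points too. *)
Lemma ratio_sqrt (R : rcfType) (u v : R) : 0 <= u -> 0 <= v ->
  u / Num.sqrt (u * v) = Num.sqrt (u / v).
Proof.
move=> u0 v0; rewrite !sqrtrM// sqrtrV// invfM.
have [->|su] := eqVneq (Num.sqrt u) 0.
  by rewrite !(invr0, mul0r, mulr0).
by rewrite -{1}(sqr_sqrtr u0) expr2 mulrA mulfK.
Qed.

Lemma eq_measure_ae d (T : measurableType d) (R : realType)
    (mu : {measure set T -> \bar R}) (A B : set T) :
  measurable A -> measurable B -> {ae mu, forall w, A w <-> B w} ->
  mu A = mu B.
Proof.
move=> mA mB [N [mN N0 AB]].
have dropN C : measurable C -> mu C = mu (C `\` N).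
  move=> mC; rewrite (measureDI mu mC mN) (subset_measure0 _ mN (@subIsetr _ _
    _) N0) ?adde0//.
  exact: measurableI.
rewrite (dropN A)// (dropN B)//; congr (mu _).
by apply/seteqP; split=> w [Cw Nw]; split=> //;
  have /contrapT[h1 h2] : ~ ~ (A w <-> B w) by [move/AB|]; [exact: h1|exact:
    h2].
Qed.

Lemma sin2_onto (R : realType) (c : R) : 0 <= c <= 1 ->
  exists2 phi : R, 0 <= phi <= pi / 2 & sin phi ^+ 2 = c.
Proof.
move=> c01; have pi2 : (0 : R) <= pi / 2 by rewrite divr_ge0// ltW// pi_gt0.
have csin2 : {within `[0, pi / 2], continuous (fun y : R => sin y ^+ 2)}.
  apply: continuous_subspaceT => y.
  apply: (cvg_comp _ (fun z : R => z ^+ 2)); first exact: continuous_sin.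
  exact: exprn_continuous.
have [|phi pI pE] := IVT (v := c) pi2 csin2.
  by rewrite sin0 expr0n sin_pihalf expr1n/= min_l// max_r.
by exists phi => //; move: pI; rewrite in_itv.
Qed.

Section half_line_law.
Context d (T : measurableType d) (R : realType) (P : probability T R).
Variable x : R -> {RV P >-> R}.
Hypothesis hx : standard_brownian_motion P x.
Variables (t : R) (t_gt0 : 0 < t).
Notation mu := (@lebesgue_measure R).

(** The law with [s = 0] concerns a sure event, so it yields the probability of the condition
    itself, as a Wallis integral equal to the first arcsine weight. *)
Lemma end_pos_half : P (end_pos x t) = (2^-1)%:E.
Proof.
have pi0 : pi != 0 :> R by rewrite gt_eqF// pi_gt0.
have := @pos_fraction_law _ _ _ _ _ hx _ t_gt0 0 0 `[0, pi / 2]%classic.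
rewrite normr0 => /(_ ler01).
rewrite (_ : [set w : T | _] = setT); last first.
  by apply/seteqP; split=> // w _ /=; rewrite mul0r.
rewrite setTI => ->; last first.
  by apply/seteqP; split=> y /=; rewrite in_itv/= mul0r lexx andbT.
have M := @quarter_momentE R 1 1 (leqnn 1); rewrite subnn in M.
have iM : mu.-integrable `[0, pi / 2] (EFin \o (fun y => sin y ^+ 2)).
  apply: integrable_quarter => y.
  apply: (cvg_comp _ (fun z : R => z ^+ 2)); first exact: continuous_sin.
  exact: exprn_continuous.
rewrite -[X in (_ * X)%E]fineK; last exact: integrable_fin_num.
rewrite -EFinM; congr (_ %:E).
have -> : fine (\int[mu]_(y in `[0%R, pi / 2%R]) (sin y ^+ 2)%:E) =
    @quarter_moment R 1 0.
  by rewrite /quarter_moment /quarter_int /Rintegral; congr fine;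
    apply: eq_integral => y _; rewrite expr0 expr1 mulr1.
have a1 := @arcsine_weightS R 0; rewrite arcsine_weight0 in a1 M.
move: M; rewrite binn mul1r => ->.
rewrite (_ : arcsine_weight 1 = 2^-1); last by move: a1; lra.
by move: pi pi0 => p p0; field.
Qed.

Lemma end_neq0 : {ae P, forall w, x t w != 0}.
Proof.
exists [set w | x t w = 0]; split.
- have mx : measurable_fun setT (x t : T -> R) by [].
  exact: (measurable_preimageT mx (measurable_set1 0)).
- exact: brownian_eq0.
- by move=> w /= /negP; rewrite negbK => /eqP.
Qed.

Let D : set R := `[0, t]%classic.
Let D0 : D `<=` `[0, +oo[.
Proof. by move=> u; rewrite /D /= !in_itv/= andbT => /andP[]. Qed.
Let mD : measurable D. Proof. exact: measurable_itv. Qed.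
Let D' : set R := `[0, t[%classic.
Let D0' : D' `<=` `[0, +oo[.
Proof. by move=> u; rewrite /D' /= !in_itv/= andbT => /andP[]. Qed.
Let mD' : measurable D'. Proof. exact: measurable_itv. Qed.

Let pos : set R := [set u | 0 < u].
Let nneg : set R := [set u | 0 <= u].
Let npos : set R := [set u | u <= 0].

Let mpos : measurable pos.
Proof. by apply: measurable_set_ltr; [exact: measurable_cst|exact:
  measurable_id]. Qed.
Let mnneg : measurable nneg.
Proof. by apply: measurable_set_ler; [exact: measurable_cst|exact:
  measurable_id]. Qed.
Let mnpos : measurable npos.
Proof. by apply: measurable_set_ler; [exact: measurable_id|exact:
  measurable_cst]. Qed.

Let eq_measure_null (A B N : set R) : measurable A -> measurable B ->
  measurable N -> mu N = 0%E -> A `<=` B -> B `<=` A `|` N -> mu A = mu B.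
Proof.
move=> mA mB mN N0 AB BAN; apply: eq_measure_ae => //.
exists N; split=> // w; apply: contra_notP => Nw; split; first exact: AB.
by move/BAN => -[].
Qed.

Lemma occupation_nneg w : occupation x `]0, t[ [set 0] w = 0%E ->
  occupation x `[0, t] [set u | 0 <= u] w =
  occupation x `[0, t[ [set u | 0 < u] w.
Proof.
move=> w0; apply/esym.
have mZ : measurable (`]0, t[ `&` [set s | [set 0] (x s w)]).
  apply: (measurable_sojourn_path hx t_gt0) => //.
  by move=> u /=; rewrite !in_itv/= andbT => /andP[/ltW].
apply: (@eq_measure_null _ _ ([set 0] `|` [set t] `|` (`]0, t[ `&` [set s |
  [set 0] (x s w)]))).
- exact: (measurable_sojourn_path hx t_gt0).
- exact: (measurable_sojourn_path hx t_gt0).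
- by apply: measurableU => //; exact: measurableU.
- have m1 (c : R) : measurable [set c] by [].
  have mU : measurable ([set 0] `|` [set t]) by exact: measurableU.
  have z (c : R) : mu [set c] = 0%E by exact: lebesgue_measure_set1.
  have zU : mu ([set 0] `|` [set t]) = 0%E.
    exact: (null_set_setU (mu := mu) (m1 0) (m1 t) (z 0) (z t)).
  exact: (null_set_setU (mu := mu) mU mZ zU w0).
- move=> s [/= sD sx]; split; last exact: ltW.
  by move: sD; rewrite !in_itv/= => /andP[-> /ltW].
- move=> s [/= sD sx]; move: sD; rewrite in_itv/= => /andP[s0 st].
  have [->|s0'] := eqVneq s 0; first by right; left; left.
  have [->|st'] := eqVneq s t; first by right; left; right.
  have [xs|xs] := eqVneq (x s w) 0.
    by right; right; split=> //=; rewrite in_itv/= !lt_neqAle s0 st eq_sym s0'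
      st'.
  left; split; first by rewrite /= in_itv/= s0 lt_neqAle st' st.
  by rewrite /= lt_neqAle sx eq_sym xs.
Qed.

(** Valid for every path, since being nonpositive is the exact complement of being positive; only
    the single time [t] is discarded. *)
Lemma occupation_npos w :
  occupation x `[0, t] [set u | u <= 0] w =
  (t%:E - occupation x `[0%R, t[ [set u | (0 < u)%R] w)%E.
Proof.
have mA := measurable_sojourn_path hx t_gt0 w D0' mD' mnpos.
have mB := measurable_sojourn_path hx t_gt0 w D0' mD' mpos.
have -> : occupation x D npos w = occupation x D' npos w.
  apply/esym; apply: (@eq_measure_null _ _ [set t]) => //.
  - exact: (measurable_sojourn_path hx t_gt0).
  - exact: lebesgue_measure_set1.
  - move=> s [/= sD sx]; split=> //.
    by move: sD; rewrite /D' /D /= !in_itv/= => /andP[-> /ltW].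
  - move=> s [/= sD sx]; move: sD; rewrite /D /= in_itv/= => /andP[s0 st].
    have [->|st'] := eqVneq s t; first by right.
    by left; split=> //; rewrite /D' /= in_itv/= s0 lt_neqAle st' st.
have fo : occupation x D' pos w \is a fin_num.
  by rewrite ge0_fin_numE// (le_lt_trans (occupation_le hx t_gt0 _ mpos))//
    ltry.
have -> : t%:E = (occupation x D' npos w + occupation x D' pos w)%E.
  rewrite /occupation -measureU//.
    transitivity (mu D'); first by rewrite /D' /= lebesgue_measure_itv/=
      lte_fin t_gt0 oppr0 adde0.
    congr (mu _); apply/seteqP; split=> s; last by move=> [|] [].
    by move=> Ds; case: (leP (x s w) 0) => xs; [left|right].
  by apply/seteqP; split=> // s [[_ xs] [_]]; rewrite /npos/pos/= in xs *;
    rewrite ltNge xs.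
by rewrite addeK.
Qed.

Let B0 : set T := [set w | 0 <= x t w].
Let mB0 : measurable B0. Proof. exact: measurable_set_ler. Qed.

Let B0_end : {ae P, forall w, B0 w <-> end_pos x t w}.
Proof.
have := end_neq0; apply: filterS => w xt.
by rewrite /B0 /end_pos/=; split; [rewrite lt_neqAle eq_sym xt|exact: ltW].
Qed.

Let PB0 : P B0 = (2^-1)%:E.
Proof.
rewrite (@eq_measure_ae _ _ _ P _ _ mB0 (measurable_end_pos x t) B0_end).
exact: end_pos_half.
Qed.

(** Dividing by 1/2 produces a factor 2, kept next to [I] because the substituted integrals carry it
    inside the integrand. *)
Let cond_half (A C : set T) (I : \bar R) :
  measurable A -> measurable C ->
  {ae P, forall w, A w <-> C w} ->
  P (C `&` end_pos x t) = ((2 / pi)%:E * I)%E ->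
  cond_prob P A B0 = ((2 / pi)%:E * (2%:E * I))%E.
Proof.
move=> mA mC AC CE; rewrite /cond_prob PB0.
have -> : P (A `&` B0) = ((2 / pi)%:E * I)%E.
  apply: (eq_trans _ CE); apply: eq_measure_ae.
  - exact: measurableI.
  - by apply: measurableI => //; exact: measurable_end_pos.
  - by have := B0_end; apply: filterS2 AC => w h1 h2; split=> -[/h1 ? /h2].
by rewrite inver invr_eq0 pnatr_eq0/= invrK -muleA [(I * _)%E]muleC.
Qed.

Let occ w := occupation x `[0, t[ [set u | 0 < u] w.

Let fin_occ w : occ w \is a fin_num.
Proof.
by rewrite ge0_fin_numE// (le_lt_trans (occupation_le hx t_gt0 _ mpos))// ltry.
Qed.

Let measurable_event (B : set R) (c : \bar R) : measurable B ->
  measurable [set w | (occupation x `[0%R, t] B w <= c)%E].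
Proof.
move=> mB; rewrite -[X in measurable X]setTI; apply: measurable_lee => //.
exact: (measurable_occupation hx t_gt0).
Qed.

Let measurable_fraction_event (s c : R) :
  measurable [set w | s * (pos_fraction x t w - c) <= 0].
Proof.
apply: measurable_set_ler; last exact: measurable_cst.
apply: measurable_funM => //; apply: measurable_funB => //.
exact: (measurable_pos_fraction hx t_gt0).
Qed.

Let integral_2sin2 (a b : R) :
  (\int[mu]_(y in `[a, b]) (2 * sin y ^+ 2)%:E =
   2%:E * \int[mu]_(y in `[a, b]) (sin y ^+ 2)%:E)%E.
Proof.
rewrite -ge0_integralZl//=.
- by apply: measurable_funTS; apply/measurable_EFinP; apply: measurable_funX;
    apply: continuous_measurable_fun; exact: continuous_sin.
- by move=> y _; rewrite lee_fin sqr_ge0.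
Qed.

Lemma cond_occupation_nneg (r : R) : 0 <= r <= 1 ->
  cond_prob P [set w | (occupation x `[0%R, t] [set u | (0 <= u)%R] w <= (r *
    t)%:E)%E]
    [set w | 0 <= x t w] =
  ((2 / pi)%:E * \int[mu]_(y in `[0%R, r]) (Num.sqrt (y / (1 - y)))%:E)%E.
Proof.
(* Writing [r] as a squared sine makes the region of angles the interval from 0 to [phi]. *)
move=> /sin2_onto[phi phi01 <-]; have /andP[p0 p1] := phi01.
rewrite integral_odds// integral_2sin2.
apply: (@cond_half _ [set w | 1 * (pos_fraction x t w - sin phi ^+ 2) <= 0] _)
  => //.
- exact: measurable_event.
- have := occupation_eq0 hx t_gt0; apply: filterS => w w0.
  rewrite /= occupation_nneg// -/(occ w) -(fineK (fin_occ w)) lee_fin.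
  by rewrite mul1r subr_le0 /pos_fraction ler_pdivrMr.
- apply: (pos_fraction_law hx t_gt0); first by rewrite normr1.
  apply/seteqP; split=> y; rewrite /= in_itv/= mul1r subr_le0.
    move=> /andP[y0 yp]; rewrite y0 (le_trans yp p1)/=.
    move: yp; rewrite le_eqVlt => /predU1P[->//|yp].
    by rewrite ltW// sin2_lt.
  move=> /andP[/andP[y0 y1]]; rewrite y0 !leNgt; apply: contra => py.
  exact: sin2_lt.
Qed.

Lemma cond_occupation_npos (r : R) : 0 <= r <= 1 ->
  cond_prob P [set w | (occupation x `[0%R, t] [set u | (u <= 0)%R] w <= (r *
    t)%:E)%E]
    [set w | 0 <= x t w] =
  ((2 / pi)%:E * \int[mu]_(y in `[0%R, r]) (Num.sqrt ((1 - y) / y))%:E)%E.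
Proof.
move=> /andP[r0 r1].
have : 0 <= 1 - r <= 1 by rewrite subr_ge0 r1 gerBl r0.
move=> /sin2_onto[phi phi01 phiE]; have /andP[p0 p1] := phi01.
have -> : r = cos phi ^+ 2 by rewrite cos2sin2 phiE opprB addrC subrK.
rewrite integral_odds'// integral_2sin2.
(* A nonpositive time of at most [r * t] means a positive fraction of at least 1 - r, which is the
   squared sine of [phi]; hence the sign -1. *)
apply: (@cond_half _ [set w | -1 * (pos_fraction x t w - sin phi ^+ 2) <= 0] _)
  => //.
- exact: measurable_event.
- apply: aeW => w; rewrite /= occupation_npos -/(occ w) -(fineK (fin_occ w)).
  rewrite -EFinB lee_fin mulN1r opprB subr_le0 /pos_fraction ler_pdivlMr//.
  by rewrite -/(occ w) cos2sin2 mulrBl mul1r lerD2l lerN2.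
- apply: (pos_fraction_law hx t_gt0); first by rewrite normrN1.
  apply/seteqP; split=> y; rewrite /= in_itv/= mulN1r opprB subr_le0.
    move=> /andP[py yp]; rewrite yp (le_trans p0 py)/=.
    move: py; rewrite le_eqVlt => /predU1P[->//|yp'].
    by rewrite ltW// sin2_lt.
  move=> /andP[/andP[y0 ->]]; rewrite andbT !leNgt; apply: contra => py.
  exact: sin2_lt.
Qed.

End half_line_law.

Theorem theorem7 (d : measure_display) (T : measurableType d) (R : realType)
    (P : probability T R) (x : R -> {RV P >-> R}) (t r : R)
    (hx : standard_brownian_motion P x) (ht : 0 < t) (hr0 : 0 <= r)
    (hr1 : r <= 1) :
  [/\ cond_prob P
        [set w | (lebesgue_measure
                    [set tau : R | 0 <= tau <= t /\ 0 <= x tau w]%R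
                  <= (r * t)%:E)%E]
        [set w | 0 <= x t w]
      = ((2 / pi)%:E *
         \int[lebesgue_measure]_(y in `[0%R, r])
           (y / Num.sqrt (y * (1 - y)))%:E)%E,
      ((2 / pi)%:E *
         \int[lebesgue_measure]_(y in `[0%R, r])
           (y / Num.sqrt (y * (1 - y)))%:E)%E
      = ((2 / pi)%:E *
         \int[lebesgue_measure]_(y in `[0%R, r])
           (Num.sqrt (y / (1 - y)))%:E)%E,
      cond_prob P
        [set w | (lebesgue_measure
                    [set tau : R | 0 <= tau <= t /\ x tau w <= 0]%R
                  <= (r * t)%:E)%E]
        [set w | 0 <= x t w]
      = ((2 / pi)%:E *
         \int[lebesgue_measure]_(y in `[0%R, r])
           ((1 - y) / Num.sqrt (y * (1 - y)))%:E)%E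
    & ((2 / pi)%:E *
         \int[lebesgue_measure]_(y in `[0%R, r])
           ((1 - y) / Num.sqrt (y * (1 - y)))%:E)%E
      = ((2 / pi)%:E *
         \int[lebesgue_measure]_(y in `[0%R, r])
           (Num.sqrt ((1 - y) / y))%:E)%E].
Proof.
have r01 : 0 <= r <= 1 by rewrite hr0.
have Inneg : (\int[lebesgue_measure]_(y in `[0%R, r])
      (y / Num.sqrt (y * (1 - y)))%:E =
    \int[lebesgue_measure]_(y in `[0%R, r]) (Num.sqrt (y / (1 - y)))%:E)%E.
  apply: eq_integral => y; rewrite inE/= in_itv/= => /andP[y0 yr].
  by rewrite ratio_sqrt// subr_ge0 (le_trans yr).
have Inpos : (\int[lebesgue_measure]_(y in `[0%R, r])
      ((1 - y) / Num.sqrt (y * (1 - y)))%:E =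
    \int[lebesgue_measure]_(y in `[0%R, r]) (Num.sqrt ((1 - y) / y))%:E)%E.
  apply: eq_integral => y; rewrite inE/= in_itv/= => /andP[y0 yr].
  by rewrite [y * _]mulrC ratio_sqrt// subr_ge0 (le_trans yr).
rewrite Inneg Inpos; split=> //.
(* The set of times in the statement is the one measured by [occupation], up to unfolding. *)
- exact: cond_occupation_nneg.
- exact: cond_occupation_npos.
Qed.
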